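(* Let $\mathcal{H}$ be a separable infinite-dimensional Hilbert space and let $\{f_n\}_{n=0}^{\infty}\subseteq\mathcal{H}$ be a sequence with analysis operator $A_{f_n}$. The following are equivalent: (1) $\{f_n\}_{n=0}^{\infty}$ is a CO sequence. (2) $A_{f_n}$ is surjective (onto $\ell^2(\mathbb{N})$). (3) There is an infinite-dimensional (not necessarily closed) subspace $D\subseteq\mathcal{H}$ and $A>0$ such that $$A\|f\|^2\le\sum_{n=0}^{\infty}|\langle f,f_n\rangle|^2<\infty\quad\text{for all }f\in D,$$ and there is a sequence $\{g_n\}_{n=0}^\infty\subseteq D$ such that $\langle f_n,g_k\rangle=\delta_{nk}$ for all $n,k$. (4) $\{f_n\}_{n=0}^{\infty}$ is a Riesz-Fischer sequence. Furthermore: (a) If (3) holds with a subspace $D$ that is closed, then $\{f_n\}$ is an SCO sequence. Conversely, if $\{f_n\}$ is an SCO sequence, then $D$ in (3) may be chosen to be closed. (b) If (3) holds with a subspace $D$ satisfying $\overline{D}=\mathcal{H}$, then $\{f_n\}$ is an ICO sequence. Conversely, if $\{f_n\}$ is an ICO sequence, then $D$ in (3) may be chosen so that $\overline{D}=\mathcal{H}$. (c) If (3) holds with a subspace $D$, then there exists a bounded operator $T\in B(\ell^2(\mathbb{N}),\mathcal{H})$ such that $(TT^* )^{1/2}f_n\in\overline{D}$ for all $n$ and $\{(TT^* )^{1/2}f_n\}_{n=0}^\infty$ is an orthonormal basis of $\overline{D}$.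
   Context: The (possibly unbounded) analysis operator of $\{f_n\}_{n=0}^\infty\subseteq\mathcal{H}$ is $A_{f_n}:\operatorname{dom}(A_{f_n})\to\ell^2(\mathbb{N})$, $A_{f_n}(f)=\{\langle f,f_n\rangle\}_{n=0}^\infty$, with $\operatorname{dom}(A_{f_n})=\{f\in\mathcal{H}:\{\langle f,f_n\rangle\}_{n=0}^\infty\in\ell^2(\mathbb{N})\}$. Sequences in $\ell^2(\mathbb{N})$ are indexed from $n=0$. $\{f_n\}_{n=0}^\infty$ is a CO (continuously orthonormalizable) sequence if there is a bounded linear operator $B\in B(\mathcal{H})$ such that $\{Bf_n\}_{n=0}^\infty$ is an orthonormal basis of $\mathcal{H}$. It is an ICO (respectively SCO) sequence if such a $B$ can be chosen injective (respectively surjective). $\{f_n\}_{n=0}^\infty$ is a Riesz-Fischer sequence if there is a constant $c>0$ such that $c\sum_{n=0}^k|a_n|^2\le\left\|\sum_{n=0}^k a_nf_n\right\|^2$ for all finite scalar sequences $a_0,\dots,a_k$ (all $k\geq 0$). *)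

(* Defs.v *)
From HB Require Import structures.
From mathcomp Require Import all_boot all_order all_algebra sesquilinear.
From mathcomp Require Import all_classical all_reals all_analysis.
From mathcomp Require Import complex ring.

Set Implicit Arguments.
Unset Strict Implicit.
Unset Printing Implicit Defensive.

Import Order.TTheory GRing.Theory Num.Theory.
Import numFieldNormedType.Exports.

Local Open Scope classical_set_scope.
Local Open Scope ring_scope.

(* The norm of a normed space over R[i] takes its values in R[i], where they
   are nonnegative reals; rnorm reads them in R. *)
Definition rnorm (R : realType) (V : normedZmodType R[i]) (x : V) : R :=
  complex.Re `|x|.

Definition sqsum (R : realType) (a : nat -> R[i]) : \bar R :=
  (\sum_(0 <= n <oo) ((rnorm (a n) ^+ 2)%:E))%E.

Definition ell2 (R : realType) : set (nat -> R[i]) :=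
  [set a | (sqsum a < +oo)%E].
Arguments ell2 R : clear implicits.

Section Ell2Lmodule.
Variable R : realType.

Lemma rnorm_ge0 (V : normedZmodType R[i]) (x : V) : 0 <= rnorm x.
Proof. by have := normr_ge0 x; rewrite lecE => /andP[_]. Qed.

Lemma rnormE (V : normedZmodType R[i]) (x : V) : ((rnorm x)%:C)%C = `|x|.
Proof.
have := normr_ge0 x; rewrite /rnorm.
by case: `|x| => r i; rewrite lecE /= => /andP[/eqP -> _].
Qed.

Lemma ler_rnormD (V : normedZmodType R[i]) (x y : V) :
  rnorm (x + y) <= rnorm x + rnorm y.
Proof. by rewrite -lecR rmorphD /= !rnormE ler_normD. Qed.

Lemma rnormM (x y : R[i]) : rnorm (x * y) = rnorm x * rnorm y.
Proof. by apply: complexI; rewrite rmorphM /= !rnormE normrM. Qed.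

Lemma ell2_submod_closed : submod_closed (mem (ell2 R)).
Proof.
split=> [|c x y]; rewrite !inE /ell2 /sqsum /=.
  by rewrite eseries0 // => n _ _; rewrite /rnorm normr0 /= expr0n.
move=> x2 y2.
pose s (a : nat -> R[i]) n : \bar R := (rnorm (a n) ^+ 2)%:E.
have s0 a n : (0 <= s a n)%E by rewrite lee_fin sqr_ge0.
pose k := 2 * rnorm c ^+ 2.
have k0 : 0 <= k by rewrite mulr_ge0 // sqr_ge0.
apply: (@le_lt_trans _ _
  (\sum_(0 <= n <oo) (k%:E * s x n + 2%:E * s y n))%E).
  apply: lee_nneseries => [n _ _|n _]; first by rewrite lee_fin sqr_ge0.
  rewrite /s -!EFinM -EFinD lee_fin.
  apply: (@le_trans _ _ ((rnorm c * rnorm (x n) + rnorm (y n)) ^+ 2)).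
    rewrite lerXn2r ?nnegrE ?rnorm_ge0 ?addr_ge0 ?mulr_ge0 ?rnorm_ge0 //.
    by rewrite -rnormM ler_rnormD.
  rewrite -subr_ge0 /k.
  have -> : 2 * rnorm c ^+ 2 * rnorm (x n) ^+ 2 + 2 * rnorm (y n) ^+ 2 -
            (rnorm c * rnorm (x n) + rnorm (y n)) ^+ 2 =
            (rnorm c * rnorm (x n) - rnorm (y n)) ^+ 2 by ring.
  exact: sqr_ge0.
rewrite nneseriesD; last 2 first.
- by move=> n _ _; rewrite mule_ge0 // lee_fin.
- by move=> n _ _; rewrite mule_ge0 // lee_fin.
rewrite !nneseriesZl //; try by move=> n _; exact: s0.
by apply: lte_add_pinfty; apply: lte_mul_pinfty; rewrite ?lee_fin //.
Qed.

End Ell2Lmodule.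

Definition ell2_pred (R : realType) : {pred nat -> R[i]} := mem (ell2 R).
Arguments ell2_pred R : clear implicits.

HB.instance Definition _ (R : realType) :=
  GRing.isSubmodClosed.Build R[i] (nat -> R[i]) (ell2_pred R)
    (ell2_submod_closed R).

Record ell2_type (R : realType) : Type := Ell2 {
  ell2_val :> nat -> R[i];
  ell2_valP : ell2_val \in ell2_pred R }.

HB.instance Definition _ (R : realType) := [isSub for @ell2_val R].
HB.instance Definition _ (R : realType) := [Choice of ell2_type R by <:].
HB.instance Definition _ (R : realType) :=
  [SubChoice_isSubLmodule of ell2_type R by <:].

(* The topology of R[i] as a normed space is carried by its alias R[i]^o. *)
Definition l2dot (R : realType) (a b : ell2_type R) : R[i] :=
  limn (series (fun n => a n * Num.conj (b n) : R[i]^o)).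

Definition l2norm (R : realType) (a : ell2_type R) : R :=
  Num.sqrt (fine (sqsum a)).

Definition bounded_op (R : realType) (V W : Type) (normV : V -> R)
    (normW : W -> R) (T : V -> W) : Prop :=
  exists M : R, forall x, normW (T x) <= M * normV x.

Definition is_adjoint (R : realType) (V W : Type) (dotV : V -> V -> R[i])
    (dotW : W -> W -> R[i]) (T : V -> W) (Tstar : W -> V) : Prop :=
  forall x y, dotW (T x) y = dotV x (Tstar y).

Definition lin_span (R : realType) (H : lmodType R[i]) (S : set H) : set H :=
  [set x | exists (n : nat) (a : 'I_n -> R[i]) (v : 'I_n -> H),
    (forall i, S (v i)) /\ x = \sum_i a i *: v i].

Definition infinite_dim (R : realType) (H : lmodType R[i]) (D : set H) : Prop :=
  forall s : seq H, ~ (D `<=` lin_span [set` s]).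

Definition separable_space (T : topologicalType) : Prop :=
  exists2 S : set T, countable S & dense S.

Section Sequences.
Variables (R : realType) (H : completeNormedModType R[i]).
(* {dot H for Num.conj} is linear in its first argument and conjugate-linear in
   its second one. *)
Variable dot : {dot H for Num.conj}.

Definition orthonormal_basis (E : set H) (e : nat -> H) : Prop :=
  (forall n k, dot (e n) (e k) = (n == k)%:R) /\
  closure (lin_span (range e)) = E.

Definition is_positive_sqrt (P S : H -> H) : Prop :=
  [/\ bounded_op (@rnorm R H) (@rnorm R H) S,
      is_adjoint dot dot S S,
      (forall x, 0 <= dot (S x) x) &
      forall x, S (S x) = P x].

Variable f : nat -> H.

Definition analysis_op (x : H) : nat -> R[i] := fun n => dot x (f n).

Definition analysis_dom : set H := [set x | ell2 R (analysis_op x)].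

Definition orthonormalizer (B : H -> H) : Prop :=
  bounded_op (@rnorm R H) (@rnorm R H) B /\
  orthonormal_basis [set: H] (B \o f).

Definition CO_sequence : Prop :=
  exists B : {linear H -> H}, orthonormalizer B.

Definition ICO_sequence : Prop :=
  exists2 B : {linear H -> H}, orthonormalizer B & injective B.

Definition SCO_sequence : Prop :=
  exists2 B : {linear H -> H},
    orthonormalizer B & set_surj [set: H] [set: H] B.

Definition Riesz_Fischer_sequence : Prop :=
  exists2 c : R, 0 < c & forall (k : nat) (a : nat -> R[i]),
    c * (\sum_(n < k.+1) rnorm (a n) ^+ 2) <=
    rnorm (\sum_(n < k.+1) a n *: f n) ^+ 2.

Definition bounded_below_biorthogonal (D : set H) : Prop :=
  [/\ submod_closed (mem D),
      infinite_dim D,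
      (exists2 A : R, 0 < A & forall x, D x ->
         ((A * rnorm x ^+ 2)%:E <= sqsum (analysis_op x) < +oo)%E) &
      exists2 g : nat -> H, (forall n, D (g n)) &
        forall n k, dot (f n) (g k) = (n == k)%:R].

End Sequences.

(* Main.v *)
From HB Require Import structures.
Require Import Defs.
From mathcomp Require Import all_boot all_order all_algebra sesquilinear.
From mathcomp Require Import all_classical all_reals all_analysis.
From mathcomp Require Import complex ring lra.

Set Implicit Arguments.
Unset Strict Implicit.
Unset Printing Implicit Defensive.

Import Order.TTheory GRing.Theory Num.Theory.
Import numFieldNormedType.Exports.

Local Open Scope classical_set_scope.
Local Open Scope ring_scope.

(** The theorem holds because all four conditions say that [f] has a dual Bessel
    sequence: vectors [g n] with [<f n, g k> = delta_nk] and
    [|sum a_n g_n|^2 <= C sum |a_n|^2] ([has_dual]).  Given such a [g] and an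
    orthonormal basis [h] of the space,

    - [B x = sum <x, g n> h n] is bounded and sends [f n] to [h n];
    - [x = sum a_n g_n] solves [<x, f n> = a_n] for every square-summable [a];
    - on the span of [g] the analysis coefficients of [sum a_n g_n] are the [a_n],
      so the Bessel bound becomes the lower bound on that span;
    - [sum |a_n|^2 = <sum a_n f_n, sum a_n g_n>] and Cauchy-Schwarz give the
      Riesz-Fischer inequality.

    Conversely a bounded operator that orthonormalizes [f], or a bounded below
    subspace, yields the Riesz-Fischer inequality at once; surjectivity of the
    analysis operator yields it through the uniform boundedness principle; and the
    Riesz-Fischer inequality yields [g] by orthogonal projection
    ([Riesz_Fischer_dual]).

    For the refinements, let [D] be bounded below with dual sequence [g].  Then
    [D] lies in the closed span of [g] ([bounded_below_dual]).  If [D] is dense,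
    the kernel of [B], which is the orthogonal complement of [g], is therefore
    trivial.  If [D] is closed, projecting [f] to [D] gives a Bessel sequence dual
    to [g], whose combinations are preimages under [B].  In the other direction
    the range of the adjoint of an orthonormalizer [B] is bounded below; it is
    closed when [B] is onto and dense when [B] is injective.

    Finally, let [T] be the synthesis operator of [g].  The root [S] of [T T^*]
    satisfies [S (S (f n)) = g n], whence
    [<S (f n), S (f k)> = <g n, f k> = delta_nk], and density of the range of [S]
    in the closure of [D] makes this orthonormal sequence a basis of it
    ([bounded_below_sqrt]). *)

(** * Real norms and convergence over the complex numbers *)

Section RealNorm.
Variable R : realType.

Section Zmod.
Variable V : normedZmodType R[i].
Implicit Types x y : V.

Lemma rnorm0 : rnorm (0 : V) = 0.
Proof. by rewrite /rnorm normr0. Qed.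

Lemma rnorm0_eq0 x : rnorm x = 0 -> x = 0.
Proof. by move=> x0; apply/normr0_eq0; rewrite -rnormE x0. Qed.

Lemma rnormN x : rnorm (- x) = rnorm x.
Proof. by rewrite /rnorm normrN. Qed.

Lemma rnorm_distC x y : rnorm (x - y) = rnorm (y - x).
Proof. by rewrite -rnormN opprB. Qed.

Lemma ler_rnormB x y : rnorm (x - y) <= rnorm x + rnorm y.
Proof. by rewrite -(rnormN y) ler_rnormD. Qed.

Lemma ler_rnorm_dist x y z : rnorm (x - z) <= rnorm (x - y) + rnorm (y - z).
Proof. by rewrite -{1}(subrK y x) -addrA ler_rnormD. Qed.

Lemma ler_rnormDB x y : rnorm x - rnorm y <= rnorm (x - y).
Proof. by rewrite lerBlDr -{1}(subrK y x) ler_rnormD. Qed.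

End Zmod.

Lemma rnormZ (V : normedModType R[i]) a (x : V) :
  rnorm (a *: x) = rnorm a * rnorm x.
Proof. by apply: complexI; rewrite rmorphM /= !rnormE normrZ. Qed.

Lemma sqr_rnorm (a : R[i]) : ((rnorm a ^+ 2)%:C)%C = a * Num.conj a.
Proof. by rewrite rmorphXn /= rnormE normCK. Qed.

Lemma rnorm_conj (a : R[i]) : rnorm (Num.conj a) = rnorm a.
Proof. by rewrite /rnorm norm_conjC. Qed.

Lemma rnormC (r : R) : rnorm (r%:C)%C = `|r|.
Proof. by apply: complexI; rewrite rnormE normc_def /= expr0n addr0 sqrtr_sqr. Qed.

Lemma rnormC_ge0 (r : R) : 0 <= r -> rnorm (r%:C)%C = r.
Proof. by move=> r0; rewrite rnormC ger0_norm. Qed.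

Lemma ler_Re_rnorm (a : R[i]) : complex.Re a <= rnorm a.
Proof.
apply: le_trans (ler_norm _) _; case: a => x y.
rewrite /rnorm normc_def /= -sqrtr_sqr ler_wsqrtr // lerDl sqr_ge0 //.
Qed.

Lemma rnorm1 : rnorm (1 : R[i]) = 1.
Proof. by rewrite /rnorm normr1. Qed.

Lemma conjC_real (r : R) : Num.conj (r%:C)%C = (r%:C)%C :> R[i].
Proof. by apply/CrealP/complex_realP; exists r. Qed.

Lemma ReZ (r : R) (a : R[i]) : complex.Re ((r%:C)%C * a) = r * complex.Re a.
Proof. by case: a => x y /=; rewrite mul0r subr0. Qed.

Section Convergence.
Variable V : normedModType R[i].
Implicit Types (u : nat -> V) (l x : V) (D : set V).

Lemma cvg_rnormP u l :
  u @ \oo --> l <->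
  forall e : R, 0 < e -> exists N, forall n, (N <= n)%N -> rnorm (u n - l) < e.
Proof.
split=> [/cvgrPdist_lt ul e e0|ul].
  have /ul [N _ uN] : 0 < (e%:C)%C :> R[i] by rewrite ltcR.
  exists N => n /uN /=.
  by rewrite -rnormE ltcR rnorm_distC.
apply/cvgrPdist_lt => e e0.
have [r r0 ->] : exists2 r : R, 0 < r & e = (r%:C)%C.
  by move: e0; case: e => a b; rewrite ltcE /= => /andP[/eqP -> a0]; exists a.
have [N uN] := ul r r0; exists N => // n /uN /=.
by rewrite -rnormE ltcR rnorm_distC.
Qed.

Lemma cvg_rnorm_squeeze u l (v : nat -> R) :
  (forall n, rnorm (u n - l) <= v n) -> v @ \oo --> (0 : R) -> u @ \oo --> l.
Proof.
move=> uv /cvgrPdist_lt v0; apply/cvg_rnormP => e e0.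
have [N _ vN] := v0 e e0; exists N => n /vN /=.
rewrite sub0r normrN; apply: le_lt_trans.
exact: le_trans (uv n) (ler_norm _).
Qed.

Lemma cvg_rnorm u l : u @ \oo --> l -> (fun n => rnorm (u n)) @ \oo --> rnorm l.
Proof.
move=> /cvg_rnormP ul; apply/cvgrPdist_lt => e e0.
have [N uN] := ul e e0; exists N => // n /uN /=; apply: le_lt_trans.
rewrite ler_norml lerNl opprB ler_rnormDB /=.
by rewrite rnorm_distC ler_rnormDB.
Qed.

Lemma closure_rnormP D x :
  closure D x <-> forall e : R, 0 < e -> exists2 d, D d & rnorm (x - d) < e.
Proof.
split=> [Dx e e0|Dx B /nbhs_normP[/= e e0 eB]].
  have [|d [Dd]] := Dx (ball x (e%:C)%C); first by apply: nbhsx_ballx; rewrite ltcR.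
  by rewrite -ball_normE /ball_ /= -rnormE ltcR => xd; exists d.
move: e0 eB; case: e => a b; rewrite ltcE /= => /andP[/eqP -> a0] eB.
have [d Dd xd] := Dx a a0; exists d; split=> //; apply: eB => /=.
by rewrite /ball_ /= -rnormE ltcR.
Qed.

Lemma closure_min (D E : set V) : D `<=` closure E -> closure D `<=` closure E.
Proof.
move=> DE x /closure_rnormP Dx; apply/closure_rnormP => e e0.
have e2 : 0 < e / 2 by rewrite divr_gt0.
have [d /DE/closure_rnormP/(_ _ e2)[y Ey dy] xd] := Dx _ e2.
by exists y => //; apply: le_lt_trans (ler_rnorm_dist _ d _) _; rewrite (splitr e) ltrD.
Qed.

Lemma closure_cvg D u l : (forall n, D (u n)) -> u @ \oo --> l -> closure D l.
Proof.
move=> Du /cvg_rnormP ul; apply/closure_rnormP => e /ul [N uN].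
by exists (u N) => //; rewrite rnorm_distC uN.
Qed.

Lemma closure_cvgP D x : closure D x ->
  exists2 u : nat -> V, (forall n, D (u n)) & u @ \oo --> x.
Proof.
move=> /closure_rnormP Dx.
have /choice[u uP] n : exists v, D v /\ rnorm (v - x) < n.+1%:R^-1.
  have [|d Dd xd] := Dx n.+1%:R^-1; first by rewrite invr_gt0.
  by exists d; rewrite rnorm_distC.
exists u => [n|]; first by have [] := uP n.
apply: (@cvg_rnorm_squeeze _ _ (fun n => n.+1%:R^-1)) => [n|].
  by have [_ /ltW] := uP n.
exact: cvg_harmonic.
Qed.

End Convergence.

Lemma rnorm_cauchy (V : completeNormedModType R[i]) (u : nat -> V) :
  (forall e : R, 0 < e -> exists N, forall n m, (N <= n <= m)%N ->
     rnorm (u m - u n) < e) -> cvgn u.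
Proof.
move=> uC; apply/cauchy_cvgP/cauchy_ballP => e e0.
move: e0; case: e => a b; rewrite ltcE /= => /andP[/eqP -> a0].
have a20 : 0 < a / 2 by rewrite divr_gt0.
have [N uN] := uC _ a20.
exists ([set u n | n in [set n | (N <= n)%N]], [set u n | n in [set n | (N <= n)%N]]).
  by split; exists N => // n /= Nn; exists n.
move=> [_ _] [/= [n Nn <-] [m Nm <-]].
rewrite -ball_normE /ball_ /= -rnormE ltcR.
apply: le_lt_trans (ler_rnorm_dist _ (u N) _) _.
by rewrite (splitr a) ltrD // 1?(rnorm_distC (u N)) uN // leqnn.
Qed.

End RealNorm.

(** * Square-summable sequences *)

Section SquareSummable.
Variable R : realType.
Implicit Types a b : nat -> R[i].

(** Partial sums of [sqsum]: keeping the estimates real and uniform in [k]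
    confines the extended reals to the few lemmas that pass to the limit. *)
Definition psum a (k : nat) : R := \sum_(n < k) rnorm (a n) ^+ 2.

Lemma psum_ge0 a k : 0 <= psum a k.
Proof. by apply: sumr_ge0 => n _; exact: sqr_ge0. Qed.

Lemma psumS a k : psum a k.+1 = psum a k + rnorm (a k) ^+ 2.
Proof. by rewrite /psum big_ord_recr. Qed.

Lemma psum_homo a : {homo psum a : m n / (m <= n)%N >-> m <= n}.
Proof.
apply: homo_leq => [//|x y z|n]; first exact: le_trans.
by rewrite psumS lerDl sqr_ge0.
Qed.

Lemma psum_le_sqsum a k : ((psum a k)%:E <= sqsum a)%E.
Proof.
rewrite /psum -sumEFin /sqsum -(big_mkord xpredT (fun n => (rnorm (a n) ^+ 2)%:E)).
by apply: nneseries_lim_ge => n _ _; rewrite lee_fin sqr_ge0.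
Qed.

Lemma sqsum_leP a (M : R) : (sqsum a <= M%:E)%E <-> forall k, psum a k <= M.
Proof.
split=> [aM k|aM].
  by rewrite -lee_fin; apply: le_trans aM; exact: psum_le_sqsum.
apply: lime_le.
  by apply: is_cvg_nneseries => n _ _; rewrite lee_fin sqr_ge0.
near=> k; rewrite big_mkord sumEFin lee_fin; exact: aM.
Unshelve. all: by end_near. Qed.

Lemma sqsum_ge0 a : (0 <= sqsum a)%E.
Proof.
by have := psum_le_sqsum a 0; rewrite /psum big_ord0.
Qed.

Lemma ell2E a : ell2 R a -> sqsum a = (fine (sqsum a))%:E.
Proof. by move=> a2; rewrite fineK // ge0_fin_numE // sqsum_ge0. Qed.

Lemma psum_le_ell2 a k : ell2 R a -> psum a k <= fine (sqsum a).
Proof. by move=> /ell2E a2; rewrite -lee_fin -a2 psum_le_sqsum. Qed.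

Lemma ell2_le a (M : R) : (forall k, psum a k <= M) -> ell2 R a.
Proof. by move=> /sqsum_leP aM; apply: le_lt_trans aM _; rewrite ltry. Qed.

Lemma psum_cvg a : ell2 R a -> psum a @ \oo --> fine (sqsum a).
Proof.
move=> a2; have a_cvg : cvgn (psum a).
  apply: nondecreasing_is_cvgn => [|]; first exact: psum_homo.
  by exists (fine (sqsum a)) => _ [k _ <-]; exact: psum_le_ell2.
suff -> : fine (sqsum a) = limn (psum a) by [].
apply/eqP; rewrite eq_le; apply/andP; split.
  rewrite -lee_fin -ell2E //; apply/sqsum_leP => k.
  by apply: nondecreasing_cvgn_le => //; exact: psum_homo.
by apply: limr_le => //; near=> k; exact: psum_le_ell2.
Unshelve. all: by end_near. Qed.

Lemma psum_cauchy a : ell2 R a -> forall e : R, 0 < e ->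
  exists N, forall n m, (N <= n <= m)%N -> psum a m - psum a n < e.
Proof.
move=> a2 e e0; have /cvgrPdist_lt/(_ _ e0)[N _ Na] := psum_cvg a2.
exists N => n m /andP[Nn nm]; apply: le_lt_trans (Na n Nn).
by rewrite ger0_norm ?subr_ge0 ?lerB ?psum_le_ell2.
Qed.

Definition tail (k : nat) a : nat -> R[i] := fun n => if (n < k)%N then 0 else a n.

Lemma psum_tail k a m : psum (tail k a) m = psum a m - psum a (minn k m).
Proof.
elim: m => [|m IH]; first by rewrite minn0 subrr /psum big_ord0.
rewrite psumS IH /tail; case: ltnP => km.
  by rewrite rnorm0 expr0n addr0 (minn_idPr km) !subrr.
by rewrite (minn_idPl (leqW km)) psumS; ring.
Qed.

Lemma tail_ell2 k a : ell2 R a -> ell2 R (tail k a).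
Proof.
move=> a2; apply: (@ell2_le _ (fine (sqsum a))) => m.
rewrite psum_tail; apply: le_trans (psum_le_ell2 m a2).
by rewrite lerBlDr lerDl psum_ge0.
Qed.

Lemma sqsum_tail_cvg a : ell2 R a -> forall e : R, 0 < e ->
  exists N, forall k, (N <= k)%N -> (sqsum (tail k a) <= e%:E)%E.
Proof.
move=> a2 e /(psum_cauchy a2)[N Na]; exists N => k Nk.
apply/sqsum_leP => m; rewrite psum_tail.
case: (leqP k m) => km; first by rewrite ltW // Na // Nk.
have e0 := Na k k; rewrite Nk leqnn subrr in e0.
by rewrite subrr ltW // e0.
Qed.

Definition cut (k : nat) a : nat -> R[i] := fun n => if (n < k)%N then a n else 0.

Lemma psum_cut k a m : psum (cut k a) m = psum a (minn k m).
Proof.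
elim: m => [|m IH]; first by rewrite minn0 /psum !big_ord0.
rewrite psumS IH /cut; case: ltnP => km; rewrite ?(minn_idPr km) ?psumS //.
by rewrite (minn_idPl (leqW km)) rnorm0 expr0n addr0.
Qed.

Lemma sqsum_cut k a : sqsum (cut k a) = (psum a k)%:E.
Proof.
apply/eqP; rewrite eq_le; apply/andP; split.
  by apply/sqsum_leP => m; rewrite psum_cut psum_homo // geq_minl.
by rewrite -[k in psum a k]minnn -psum_cut psum_le_sqsum.
Qed.

Definition delta (k : nat) : nat -> R[i] := fun n => (n == k)%:R.

Lemma psum_delta k m : psum (delta k) m = (k < m)%:R.
Proof.
elim: m => [|m IH]; first by rewrite /psum big_ord0.
rewrite psumS IH /delta ltnS; case: ltngtP => mk; rewrite ?eqxx /=;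
  by rewrite ?rnorm0 ?rnorm1 ?expr1n ?expr0n ?add0r ?addr0.
Qed.

Lemma psum_CS a b k :
  rnorm (\sum_(n < k) a n * Num.conj (b n)) ^+ 2 <= psum a k * psum b k.
Proof.
pose u : 'rV[R[i]]_k := \row_n a n; pose v : 'rV[R[i]]_k := \row_n b n.
have dE (x y : nat -> R[i]) : dotmx (\row_(n < k) x n) (\row_(n < k) y n) =
    \sum_(n < k) x n * Num.conj (y n).
  by rewrite dotmxE mxE; apply: eq_bigr => n _; rewrite !mxE.
have nE (x : nat -> R[i]) : dotmx (\row_(n < k) x n) (\row_(n < k) x n) =
    ((psum x k)%:C)%C.
  by rewrite dE rmorph_sum /=; apply: eq_bigr => n _; rewrite sqr_rnorm.
have [/= + _] := CauchySchwarz (@dotmx R[i] k) u v.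
by rewrite /u /v (nE a) (nE b) (dE a b) -rnormE -rmorphXn -rmorphM lecR.
Qed.

End SquareSummable.
Arguments delta {R}.

(** * Geometry of the inner product *)

Section Hilbert.
Variables (R : realType) (H : completeNormedModType R[i]).
Variable dot : {dot H for Num.conj}.
Hypothesis dotE : forall x : H, `|x| ^+ 2 = dot x x.
Implicit Types (x y z : H) (a b : nat -> R[i]) (c : R[i]) (f g h : nat -> H).

Lemma dotC x y : dot x y = Num.conj (dot y x).
Proof. by rewrite hermC /= expr0 mul1r. Qed.

Lemma dotDl x y z : dot (x + y) z = dot x z + dot y z.
Proof. exact: linearDl. Qed.

Lemma dotDr x y z : dot x (y + z) = dot x y + dot x z.
Proof. exact: linearDr. Qed.

Lemma dotBl x y z : dot (x - y) z = dot x z - dot y z.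
Proof. exact: linearBl. Qed.

Lemma dotBr x y z : dot x (y - z) = dot x y - dot x z.
Proof. exact: linearBr. Qed.

Lemma dotZl c x y : dot (c *: x) y = c * dot x y.
Proof. exact: linearZl_LR. Qed.

Lemma dotZr c x y : dot x (c *: y) = Num.conj c * dot x y.
Proof. exact: linearZr_LR. Qed.

Lemma dot0l x : dot 0 x = 0.
Proof. exact: linear0l. Qed.

Lemma dot0r x : dot x 0 = 0.
Proof. exact: linear0r. Qed.

Lemma dot_suml (I : Type) (r : seq I) (F : I -> H) x :
  dot (\sum_(i <- r) F i) x = \sum_(i <- r) dot (F i) x.
Proof. exact: linear_sumlz. Qed.

Lemma dot_sumr (I : Type) (r : seq I) (F : I -> H) x :
  dot x (\sum_(i <- r) F i) = \sum_(i <- r) dot x (F i).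
Proof. exact: linear_sumr. Qed.

Lemma dot0C x y : dot x y = 0 -> dot y x = 0.
Proof. by rewrite dotC => /eqP; rewrite conjC_eq0 => /eqP. Qed.

Lemma rnorm_dot x : ((rnorm x ^+ 2)%:C)%C = dot x x.
Proof. by rewrite rmorphXn /= rnormE dotE. Qed.

Lemma rnormE_dot x : rnorm x ^+ 2 = complex.Re (dot x x).
Proof. by rewrite -rnorm_dot. Qed.

Lemma pythagoras x y :
  dot x y = 0 -> rnorm (x + y) ^+ 2 = rnorm x ^+ 2 + rnorm y ^+ 2.
Proof.
move=> xy; rewrite !rnormE_dot dotDl !dotDr xy (dot0C xy).
by rewrite addr0 add0r raddfD.
Qed.

Lemma parallelogram x y :
  rnorm (x + y) ^+ 2 + rnorm (x - y) ^+ 2 = 2 * rnorm x ^+ 2 + 2 * rnorm y ^+ 2.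
Proof.
rewrite !rnormE_dot (dotDl x y) (dotBl x y) !dotBr !dotDr.
by rewrite !(raddfD, raddfB) /=; ring.
Qed.

Lemma dot_CS x y : rnorm (dot x y) <= rnorm x * rnorm y.
Proof.
have [->|y0] := eqVneq y 0; first by rewrite dot0r !rnorm0 mulr0.
have ny : 0 < rnorm y.
  by rewrite lt_def rnorm_ge0 andbT; apply: contra_neq y0 => /rnorm0_eq0.
have yy : dot y y != 0 by rewrite dnorm_eq0.
pose c := dot x y / dot y y.
have cy : rnorm (c *: y) = rnorm (dot x y) / rnorm y.
  rewrite rnormZ /c -rnorm_dot rnormM -fmorphV rnormC_ge0 ?invr_ge0 ?sqr_ge0 //.
  by field; rewrite gt_eqF.
have orth : dot (x - c *: y) (c *: y) = 0.
  by rewrite dotZr dotBl dotZl /c divfK // subrr mulr0.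
have := pythagoras orth; rewrite subrK => xE.
rewrite -ler_pdivrMr // -cy -(@ler_pXn2r _ 2) ?nnegrE ?rnorm_ge0 //.
by rewrite xE lerDr sqr_ge0.
Qed.

Lemma dot_cvgl (u : nat -> H) x y : u @ \oo --> x ->
  (fun n => dot (u n) y : R[i]^o) @ \oo --> (dot x y : R[i]^o).
Proof.
move=> /cvg_rnormP ux; apply/cvg_rnormP => e e0.
have y0 : 0 < rnorm y + 1 by rewrite ltr_wpDl // rnorm_ge0.
have [N uN] := ux _ (divr_gt0 e0 y0).
exists N => n /uN; rewrite ltr_pdivlMr // => un.
rewrite -[_ - _]dotBl; apply: le_lt_trans un; apply: le_trans (dot_CS _ _) _.
by rewrite ler_wpM2l ?rnorm_ge0 // lerDl.
Qed.

(** Two limits of one scalar sequence coincide; the statement hides the alias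
    of the complex numbers that carries their topology. *)
Lemma dot_cvg_unique (u : nat -> H) x y (s : nat -> R[i]) (l : R[i]) :
  u @ \oo --> x -> (s : nat -> R[i]^o) @ \oo --> (l : R[i]^o) ->
  (forall n, dot (u n) y = s n) -> dot x y = l.
Proof.
move=> /(@dot_cvgl _ _ y) ux sl us.
have e : (fun n => dot (u n) y : R[i]^o) = s by apply/funext => n; exact: us.
rewrite e in ux.
exact: (cvg_unique (@norm_hausdorff _ R[i]^o) ux sl).
Qed.

Lemma dot_cvg_adjoint (u v : nat -> H) x y x' y' :
  u @ \oo --> x' -> v @ \oo --> y' -> (forall n, dot (u n) y = dot x (v n)) ->
  dot x' y = dot x y'.
Proof.
move=> ux vy uv; rewrite (dotC x).
pose s k : R[i] := Num.conj (dot (v k) x).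
apply: (@dot_cvg_unique _ _ _ s _ ux) => [|k]; last by rewrite /s -dotC.
have /cvg_rnormP lim := @dot_cvgl _ _ x vy.
apply/cvg_rnormP => e /lim[N Nl]; exists N => n /Nl.
rewrite -rnorm_conj; congr (rnorm _ < e).
exact: (rmorphB (@Num.conj R[i])).
Qed.

(** Allows a vector to be tested against a closed span by means of finite
    combinations only. *)
Lemma closure_dot_le (D : set H) y (k : R) :
  (forall x, D x -> rnorm (dot x y) <= k * rnorm x) ->
  forall x, closure D x -> rnorm (dot x y) <= k * rnorm x.
Proof.
move=> Dk x /closure_cvgP[u Du ux].
have lim1 := cvg_rnorm (@dot_cvgl _ _ y ux).
have lim2 : (fun n => k * rnorm (u n)) @ \oo --> k * rnorm x.
  by apply: cvgMr; exact: cvg_rnorm.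
apply: (ler_cvg_to lim1 lim2).
by near=> n; exact: Dk.
Unshelve. all: by end_near. Qed.

Lemma closure_dot0 (D : set H) y :
  (forall x, D x -> dot x y = 0) -> forall x, closure D x -> dot x y = 0.
Proof.
move=> D0 x Dx; apply: rnorm0_eq0; apply/eqP; rewrite eq_le rnorm_ge0 andbT.
rewrite -(mul0r (rnorm x)); apply: closure_dot_le Dx => z Dz.
by rewrite D0 // rnorm0 mul0r.
Qed.

(** * Bessel sequences and synthesis *)

Definition lincomb g a (k : nat) : H := \sum_(n < k) a n *: g n.

Lemma lincombS g a k : lincomb g a k.+1 = lincomb g a k + a k *: g k.
Proof. by rewrite /lincomb big_ord_recr. Qed.

Lemma lincombP g c a b k :
  lincomb g (fun n => c * a n + b n) k = c *: lincomb g a k + lincomb g b k.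
Proof.
rewrite /lincomb scaler_sumr -big_split /=; apply: eq_bigr => n _.
by rewrite scalerDl scalerA.
Qed.

Lemma lincomb_tail g k a m :
  lincomb g (tail k a) m = lincomb g a m - lincomb g a (minn k m).
Proof.
elim: m => [|m IH]; first by rewrite minn0 subrr /lincomb big_ord0.
rewrite lincombS IH /tail; case: ltnP => km.
  by rewrite scale0r addr0 (minn_idPr km) !subrr.
by rewrite (minn_idPl (leqW km)) lincombS addrAC.
Qed.

Lemma lincomb_cut g k a m : (k <= m)%N -> lincomb g (cut k a) m = lincomb g a k.
Proof.
move=> km; rewrite -{2}(minn_idPl km); elim: {km} m => [|m IH].
  by rewrite minn0 /lincomb !big_ord0.
rewrite lincombS IH /cut; case: ltnP => km; rewrite ?(minn_idPr km) ?lincombS //.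
by rewrite (minn_idPl (leqW km)) scale0r addr0.
Qed.

Lemma lincomb_delta g k m : (k < m)%N -> lincomb g (delta k) m = g k.
Proof.
move=> km; rewrite /lincomb (bigD1 (Ordinal km)) //= /delta eqxx scale1r.
by rewrite big1 ?addr0 // => n /negPf; rewrite -val_eqE /= => ->; rewrite scale0r.
Qed.

Lemma dot_lincombl g a k x : dot (lincomb g a k) x = \sum_(n < k) a n * dot (g n) x.
Proof. by rewrite /lincomb dot_suml; apply: eq_bigr => n _; rewrite dotZl. Qed.

Lemma dot_lincombr g a k x :
  dot x (lincomb g a k) = \sum_(n < k) Num.conj (a n) * dot x (g n).
Proof. by rewrite /lincomb dot_sumr; apply: eq_bigr => n _; rewrite dotZr. Qed.

Lemma dot_lincomb_biorth g a k n x :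
  (forall m, dot (g m) x = (m == n)%:R) ->
  dot (lincomb g a k) x = cut k a n.
Proof.
move=> gx; rewrite /cut dot_lincombl; case: ltnP => nk.
  rewrite (bigD1 (Ordinal nk)) //= gx eqxx mulr1 big1 ?addr0 // => m.
  by rewrite -val_eqE /= gx => /negPf ->; rewrite mulr0.
by apply: big1 => m _; rewrite gx ltn_eqF ?mulr0 // (leq_trans _ nk).
Qed.

(** The bound is imposed on finite combinations, i.e. on the synthesis side;
    [bessel_dot] recovers Bessel's inequality. *)
Definition bessel (C : R) g :=
  forall a k, rnorm (lincomb g a k) ^+ 2 <= C * psum a k.

Lemma bessel_ge0 C g : bessel C g -> 0 <= C.
Proof.
move=> /(_ (delta 0) 1%N); rewrite psum_delta mulr1; exact: le_trans (sqr_ge0 _).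
Qed.

(** With [z = sum_(n < k) <x, g n> g n] the partial sum is [<x, z>], hence at most
    [|x| |z|], and [|z|] is controlled by the same partial sum. *)
Lemma bessel_dot C g x : bessel C g ->
  forall k, psum (fun n => dot x (g n)) k <= C * rnorm x ^+ 2.
Proof.
move=> gC k; set a := fun n => _; set s := psum a k.
have sE : dot x (lincomb g a k) = (s%:C)%C.
  rewrite dot_lincombr /s /psum rmorph_sum /=; apply: eq_bigr => n _.
  by rewrite sqr_rnorm mulrC.
have s0 : 0 <= s := psum_ge0 _ _.
have [->|sN0] := eqVneq s 0.
  by rewrite mulr_ge0 ?sqr_ge0 ?(bessel_ge0 gC).
have sp : 0 < s by rewrite lt_def sN0.
have := dot_CS x (lincomb g a k); rewrite sE rnormC_ge0 // => CS.
have : s ^+ 2 <= rnorm x ^+ 2 * (C * s).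
  apply: le_trans (_ : (rnorm x * rnorm (lincomb g a k)) ^+ 2 <= _).
    by rewrite ler_pXn2r // ?nnegrE ?mulr_ge0 ?rnorm_ge0.
  by rewrite exprMn ler_wpM2l ?sqr_ge0 // gC.
by rewrite expr2 mulrA ler_pM2r // mulrC.
Qed.

Lemma bessel_ell2 C g x : bessel C g -> ell2 R (fun n => dot x (g n)).
Proof. by move=> gC; apply: (@ell2_le _ _ (C * rnorm x ^+ 2)); exact: bessel_dot. Qed.

Definition synth g a : H := limn (lincomb g a).

Lemma synth_cvg C g a : bessel C g -> ell2 R a ->
  lincomb g a @ \oo --> synth g a.
Proof.
move=> gC a2; apply: rnorm_cauchy => e e0.
have C0 : 0 <= C := bessel_ge0 gC.
have C1 : 0 < C + 1 by rewrite ltr_wpDl.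
have [|N Na] := psum_cauchy a2 (_ : 0 < e ^+ 2 / (C + 1)).
  by rewrite divr_gt0 // exprn_gt0.
exists N => n m Nnm; have /andP[_ nm] := Nnm.
rewrite -(@ltr_pXn2r _ 2) ?nnegrE ?rnorm_ge0 ?(ltW e0) //.
have := gC (tail n a) m.
rewrite lincomb_tail psum_tail (minn_idPl nm) => /le_lt_trans; apply.
have /(_ n m Nnm) := Na; rewrite ltr_pdivlMr // => lt.
apply: le_lt_trans lt; rewrite mulrC ler_wpM2l ?lerDl //.
by rewrite subr_ge0 psum_homo.
Qed.

Lemma synthP C g c a b : bessel C g -> ell2 R a -> ell2 R b ->
  synth g (fun n => c * a n + b n) = c *: synth g a + synth g b.
Proof.
move=> gC a2 b2; apply: (cvg_lim (@norm_hausdorff _ H)).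
have -> : lincomb g (fun n => c * a n + b n) =
          (fun k => c *: lincomb g a k + lincomb g b k).
  by apply/funext => k; rewrite lincombP.
by apply: cvgD; [apply: cvgZr|]; exact: (synth_cvg gC).
Qed.

Lemma synth_le C g a M : bessel C g -> (forall k, psum a k <= M) ->
  rnorm (synth g a) ^+ 2 <= C * M.
Proof.
move=> gC aM; have a2 := ell2_le aM.
have lim1 := cvg_rnorm (synth_cvg gC a2).
have lim2 : (fun k => rnorm (lincomb g a k) ^+ 2) @ \oo --> rnorm (synth g a) ^+ 2.
  by rewrite expr2; apply: cvgM.
apply: (ler_cvg_to lim2 (cvg_cst (C * M))); near=> k.
by apply: le_trans (gC a k) _; rewrite ler_wpM2l // (bessel_ge0 gC).
Unshelve. all: by end_near. Qed.

Lemma synth_biorth C g a n x : bessel C g -> ell2 R a ->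
  (forall m, dot (g m) x = (m == n)%:R) -> dot (synth g a) x = a n.
Proof.
move=> gC a2 gx; apply: (dot_cvg_unique (synth_cvg gC a2)) => [|k]; last first.
  exact: dot_lincomb_biorth gx.
apply: cvg_near_cst; near=> k; rewrite /cut ifT //; near: k; exact: nbhs_infty_gt.
Unshelve. all: by end_near. Qed.

Lemma synth_delta g k : synth g (delta k) = g k.
Proof.
apply: (cvg_lim (@norm_hausdorff _ H)); apply: cvg_near_cst.
near=> m; apply: lincomb_delta; near: m; exact: nbhs_infty_gt.
Unshelve. all: by end_near. Qed.

(** The cross operator [x |-> sum_n <x, g n> h n] of two Bessel sequences.
    Orthonormalizers, their adjoints and frame operators all have this shape. *)
Definition mixed g h x : H := synth h (fun n => dot x (g n)).

Section Mixed.
Variables (C D : R) (g h : nat -> H).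
Hypotheses (gC : bessel C g) (hD : bessel D h).

Lemma mixed_linear : linear (mixed g h).
Proof.
move=> c x y; rewrite /mixed -(synthP _ hD (bessel_ell2 x gC) (bessel_ell2 y gC)).
by congr synth; apply/funext => n; rewrite dotDl dotZl.
Qed.

Definition mixed_op : {linear H -> H} :=
  HB.pack (mixed g h) (GRing.isLinear.Build _ _ _ _ (mixed g h) mixed_linear).

Lemma mixed_le x : rnorm (mixed g h x) ^+ 2 <= D * C * rnorm x ^+ 2.
Proof. by rewrite -mulrA; apply: synth_le => //; exact: bessel_dot. Qed.

Lemma mixed_bounded : bounded_op (@rnorm R H) (@rnorm R H) (mixed g h).
Proof.
exists (Num.sqrt (D * C)) => x.
have DC0 : 0 <= D * C by rewrite mulr_ge0 ?(bessel_ge0 gC) ?(bessel_ge0 hD).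
rewrite -(@ler_pXn2r _ 2) ?nnegrE ?mulr_ge0 ?sqrtr_ge0 ?rnorm_ge0 //.
by rewrite exprMn sqr_sqrtr // mixed_le.
Qed.

Lemma mixed_cvg x : lincomb h (fun n => dot x (g n)) @ \oo --> mixed g h x.
Proof. by apply: synth_cvg => //; exact: bessel_ell2. Qed.

Lemma mixed_biorth x n y : (forall m, dot (h m) y = (m == n)%:R) ->
  dot (mixed g h x) y = dot x (g n).
Proof. by move=> hy; apply: synth_biorth => //; exact: bessel_ell2. Qed.

End Mixed.

Lemma mixed_adjoint C D g h x y : bessel C g -> bessel D h ->
  dot (mixed g h x) y = dot x (mixed h g y).
Proof.
move=> gC hD.
apply: (dot_cvg_adjoint (@mixed_cvg _ _ _ _ gC hD x) (@mixed_cvg _ _ _ _ hD gC y)) => k.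
rewrite dot_lincombl dot_lincombr; apply: eq_bigr => n _.
by rewrite -dotC mulrC.
Qed.

Lemma mixed_dual g h n x :
  (forall m, dot x (g m) = (m == n)%:R) -> mixed g h x = h n.
Proof.
by move=> gx; rewrite -[RHS]synth_delta; congr synth; apply/funext => m; rewrite gx.
Qed.

(** * Subspaces and orthogonal projection *)

Lemma submodP (D : set H) : submod_closed (mem D) <->
  D 0 /\ forall c x y, D x -> D y -> D (c *: x + y).
Proof.
split=> [[D0 DP]|[D0 DP]]; split.
- by move: D0; rewrite inE.
- by move=> c x y Dx Dy; have := DP c x y; rewrite !inE; apply.
- by rewrite inE.
- by move=> c x y; rewrite !inE; exact: DP.
Qed.

Lemma submod_lincomb (D : set H) g : submod_closed (mem D) ->
  (forall n, D (g n)) -> forall a k, D (lincomb g a k).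
Proof.
move=> /submodP[D0 DP] Dg a; elim=> [|k IH]; first by rewrite /lincomb big_ord0.
by rewrite lincombS addrC; exact: DP.
Qed.

Lemma lin_span_sub (S D : set H) : submod_closed (mem D) -> S `<=` D ->
  lin_span S `<=` D.
Proof.
move=> /submodP[D0 DP] SD x [n [a [v [Sv ->]]]].
by elim/big_rec: _ => // i y _ Dy; apply: DP => //; exact: SD.
Qed.

Lemma lin_span_lincomb g a k : lin_span (range g) (lincomb g a k).
Proof. by exists k, (fun i => a i), (fun i => g i); split=> // i; exists (val i). Qed.

Lemma lin_span_gen g n : lin_span (range g) (g n).
Proof.
exists 1%N, (fun=> 1), (fun=> g n); split=> [_|]; first by exists n.
by rewrite big_ord1 scale1r.
Qed.

Lemma submod_lincombs g :
  submod_closed (mem [set x | exists a k, x = lincomb g a k]).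
Proof.
apply/submodP; split; first by exists (fun=> 0), 0%N; rewrite /lincomb big_ord0.
move=> c _ _ [a [k ->]] [b [m ->]].
exists (fun n => c * cut k a n + cut m b n), (maxn k m).
by rewrite lincombP !lincomb_cut ?leq_maxl ?leq_maxr.
Qed.

Lemma lin_spanE g : lin_span (range g) = [set x | exists a k, x = lincomb g a k].
Proof.
apply/seteqP; split=> [|_ [a [k ->]]]; last exact: lin_span_lincomb.
apply: lin_span_sub (submod_lincombs g) _ => _ [n _ <-].
by exists (delta n), n.+1; rewrite lincomb_delta.
Qed.

Lemma lin_span_submod g : submod_closed (mem (lin_span (range g))).
Proof. by rewrite lin_spanE; exact: submod_lincombs. Qed.

Lemma submod_closure (D : set H) :
  submod_closed (mem D) -> submod_closed (mem (closure D)).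
Proof.
move=> /submodP[D0 DP]; apply/submodP; split; first exact: subset_closure.
move=> c x z /closure_cvgP[u Du ux] /closure_cvgP[v Dv vz].
apply: (@closure_cvg _ _ _ (fun n => c *: u n + v n)) => [n|]; first exact: DP.
by apply: cvgD => //; apply: cvgZr.
Qed.

Lemma submod_ortho y : submod_closed (mem [set x | dot x y = 0]).
Proof.
apply/submodP; split=> /= [|c x z xy zy]; first exact: dot0l.
by rewrite dotDl dotZl xy zy mulr0 addr0.
Qed.

(** A minimizing sequence for the distance from [x] to [D] is Cauchy by the
    parallelogram law; its limit leaves a residue orthogonal to [D], since
    otherwise a step along [D] would reduce the distance. *)
Lemma orth_projection (D : set H) x : submod_closed (mem D) ->
  exists2 p, closure D p & forall d, D d -> dot (x - p) d = 0.
Proof.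
move=> /submodP[D0 DP].
have DZ c d : D d -> D (c *: d) by move=> Dd; rewrite -[_ *: _]addr0; exact: DP.
pose E := [set rnorm (x - d) ^+ 2 | d in D]; pose m := inf E.
have Em : has_inf E.
  split; first by exists (rnorm (x - 0) ^+ 2), 0.
  by exists 0 => _ [d _ <-]; exact: sqr_ge0.
have mle d : D d -> m <= rnorm (x - d) ^+ 2.
  by move=> Dd; apply: ge_inf; [case: Em|exists d].
have /choice[u uP] n : exists d, D d /\ rnorm (x - d) ^+ 2 < m + n.+1%:R^-1.
  have [|_ [d Dd <-] dm] := @inf_adherent _ E n.+1%:R^-1 _ Em; last by exists d.
  by rewrite invr_gt0.
have Du n : D (u n) by have [] := uP n.
have uB n k : rnorm (u k - u n) ^+ 2 <= 2 * n.+1%:R^-1 + 2 * k.+1%:R^-1.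
  have := parallelogram (x - u n) (x - u k).
  have -> : x - u n - (x - u k) = u k - u n by rewrite opprB addrC addrA subrK.
  have -> : x - u n + (x - u k) = 2 *: (x - 2^-1 *: (u n + u k)).
    rewrite scalerBr scalerA divff ?pnatr_eq0 // scale1r -[2]/(1 + 1) scalerDl scale1r.
    by rewrite opprD addrACA.
  have /mle mid : D (2^-1 *: (u n + u k)).
    by apply: (DZ); rewrite -[u n]scale1r; exact: DP.
  have -> : rnorm (2 *: (x - 2^-1 *: (u n + u k))) ^+ 2 =
            4 * rnorm (x - 2^-1 *: (u n + u k)) ^+ 2.
    rewrite rnormZ exprMn; congr (_ * _).
    have -> : (2 : R[i]) = ((2 : R)%:C)%C by rewrite rmorphD.
    by rewrite rnormC_ge0 // -natrX.
  have [_ un] := uP n; have [_ uk] := uP k.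
  by move: un uk mid; move: (n.+1%:R^-1) (k.+1%:R^-1) => s t; lra.
have [p up] : exists p : H, u @ \oo --> p.
  suff : cvgn u by move=> ?; exists (limn u).
  apply: rnorm_cauchy => e e0.
  have [N Ne] : exists N, 4 * N.+1%:R^-1 < e ^+ 2.
    have e4 : 0 < e ^+ 2 / 4 by rewrite divr_gt0 // exprn_gt0.
    have /cvgrPdist_lt/(_ _ e4)[N _ /(_ N (leqnn N))] := @cvg_harmonic R.
    rewrite /= sub0r normrN ger0_norm ?invr_ge0 // => lt; exists N.
    by rewrite mulrC -ltr_pdivlMr.
  exists N => n k /andP[Nn nk].
  rewrite -(@ltr_pXn2r _ 2) ?nnegrE ?rnorm_ge0 ?(ltW e0) //.
  apply: le_lt_trans (uB n k) _; apply: le_lt_trans Ne.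
  have hn : n.+1%:R^-1 <= N.+1%:R^-1 :> R by rewrite lef_pV2 ?posrE // ler_nat.
  have hk : k.+1%:R^-1 <= N.+1%:R^-1 :> R.
    by rewrite lef_pV2 ?posrE // ler_nat ltnS (leq_trans Nn).
  by move: hn hk; move: (n.+1%:R^-1) (k.+1%:R^-1) (N.+1%:R^-1) => s t r; lra.
exists p; first exact: closure_cvg Du up.
have lim d : (fun n => rnorm (x - (u n + d)) ^+ 2) @ \oo --> rnorm (x - p - d) ^+ 2.
  have xud : (fun n => x - (u n + d)) @ \oo --> x - (p + d).
    by apply: cvgB; [exact: cvg_cst|apply: cvgD => //; exact: cvg_cst].
  by rewrite -addrA -opprD !expr2; apply: cvgM; exact: cvg_rnorm.
have ple : rnorm (x - p) ^+ 2 <= m.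
  have := lim 0; rewrite subr0 => lim0.
  have lim1 : (fun n => m + n.+1%:R^-1) @ \oo --> m + 0.
    by apply: cvgD; [exact: cvg_cst|exact: cvg_harmonic].
  rewrite -[m]addr0; apply: (ler_cvg_to lim0 lim1); near=> n.
  by rewrite addr0 ltW //; have [] := uP n.
have pge d : D d -> m <= rnorm (x - p - d) ^+ 2.
  move=> Dd; apply: (ler_cvg_to (cvg_cst m) (lim d)); near=> n.
  by apply: mle; rewrite -[u n]scale1r; exact: DP.
move=> d Dd; have [->|d0] := eqVneq d 0; first exact: dot0r.
have dd0 : dot d d != 0 by rewrite dnorm_eq0.
pose t := dot (x - p) d / dot d d.
have orth : dot (x - p - t *: d) (t *: d) = 0.
  by rewrite dotZr dotBl dotZl /t divfK // subrr mulr0.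
have := pythagoras orth; rewrite subrK => pE.
have := pge _ (DZ t _ Dd); have := sqr_ge0 (rnorm (t *: d)) => t0 mt.
have /eqP : rnorm (t *: d) ^+ 2 = 0 by lra.
rewrite sqrf_eq0 => /eqP/rnorm0_eq0/eqP; rewrite scaler_eq0 (negPf d0) orbF.
by rewrite /t mulf_eq0 invr_eq0 (negPf dd0) orbF => /eqP.
Unshelve. all: by end_near. Qed.

(** * Uniform boundedness *)

(** One of the two points [x + u], [x - u] is at least as good as their average,
    where [u] has length [r] and points along [y]. *)
Lemma norming_step x y (r : R) : 0 <= r -> exists x',
  rnorm (x' - x) <= r /\ r * rnorm y <= rnorm (dot x' y).
Proof.
move=> r0; have [->|y0] := eqVneq y 0.
  by exists x; rewrite subrr !rnorm0 mulr0 rnorm_ge0.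
have ny : 0 < rnorm y.
  by rewrite lt_def rnorm_ge0 andbT; apply: contra_neq y0 => /rnorm0_eq0.
pose u := ((r / rnorm y)%:C)%C *: y.
have ru : rnorm u = r by rewrite rnormZ rnormC_ge0 ?divr_ge0 ?divfK ?gt_eqF // ltW.
have uy : dot u y = ((r * rnorm y)%:C)%C.
  rewrite dotZl -rnorm_dot -rmorphM; congr (_%:C)%C.
  by field; rewrite gt_eqF.
case: (leP (r * rnorm y) (rnorm (dot (x + u) y))) => le1.
  by exists (x + u); rewrite addrC addKr ru.
exists (x - u); split; first by rewrite addrC addKr rnormN ru.
have : r * rnorm y + r * rnorm y <= rnorm (dot (x + u) y) + rnorm (dot (x - u) y).
  apply: le_trans (ler_rnormB _ _).
  have -> : dot (x + u) y - dot (x - u) y = ((r * rnorm y + r * rnorm y)%:C)%C.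
    by rewrite -dotBl opprB addrC addrA subrK dotDl uy rmorphD.
  by rewrite rnormC ler_norm.
by move: le1; lra.
Qed.

(** Were the conclusion false, there would be [y_n] with
    [|y_n| > 2 n 3^n w_n].  Starting from 0 and moving at step [n] by at most
    [3^-n] so that [|<x, y_n>|] becomes at least [3^-n |y_n|], all later moves
    together cost at most half of that bound, so the limit [x] satisfies
    [|<x, y_n>| > n w_n] for all [n].  Weights that may vanish make the statement
    apply to estimates that are homogeneous in a parameter [i]. *)
Lemma uniform_boundedness (I : Type) (y : I -> H) (w : I -> R) :
  (forall i, 0 <= w i) ->
  (forall z, exists M : R, forall i, rnorm (dot z (y i)) <= M * w i) ->
  exists2 K : R, 0 < K & forall i, rnorm (y i) <= K * w i.
Proof.
move=> w0 bnd; apply: contrapT => nK.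
have /choice[i iP] n : exists i, (2 * n%:R * 3 ^+ n) * w i < rnorm (y i).
  apply: contrapT => ni; apply: nK.
  exists (2 * n%:R * 3 ^+ n + 1) => [|i].
    by rewrite ltr_wpDl // !mulr_ge0 // exprn_ge0.
  rewrite mulrDl mul1r; apply: le_trans (_ : _ <= (2 * n%:R * 3 ^+ n) * w i) _.
    by rewrite leNgt; apply/negP => lt; apply: ni; exists i.
  by rewrite lerDl.
(* The lengths of the moves after step [n] add up to [r n / 2]. *)
pose r n : R := 3^-1 ^+ n.
have r0 n : 0 < r n by rewrite exprn_gt0 // invr_gt0.
have /choice[step stepP] (nx : nat * H) : exists x',
    rnorm (x' - nx.2) <= r nx.1 /\
    r nx.1 * rnorm (y (i nx.1)) <= rnorm (dot x' (y (i nx.1))).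
  by apply: norming_step; exact: ltW.
pose fix s n : H := if n is m.+1 then step (m, s m) else 0.
have sS n : rnorm (s n.+1 - s n) <= r n by have [] := stepP (n, s n).
have sy n : r n * rnorm (y (i n)) <= rnorm (dot (s n.+1) (y (i n))).
  by have [] := stepP (n, s n).
have rS n : r n.+1 = 3^-1 * r n by rewrite /r exprS.
have sB n k : rnorm (s (n + k)%N - s n) <= 3 / 2 * (r n - r (n + k)%N).
  elim: k => [|k IH]; first by rewrite addn0 !subrr rnorm0 mulr0.
  apply: le_trans (ler_rnorm_dist _ (s (n + k)%N) _) _.
  by rewrite addnS; move: (sS (n + k)%N) (rS (n + k)%N) IH => + ->; lra.
have sB' n k : rnorm (s (n + k)%N - s n) <= 3 / 2 * r n.
  by apply: le_trans (sB n k) _; have := r0 (n + k)%N; lra.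
have [x sx] : exists x : H, s @ \oo --> x.
  suff : cvgn s by move=> ?; exists (limn s).
  apply: rnorm_cauchy => e e0.
  have r_cvg : r @ \oo --> 0.
    by apply: cvg_expr; rewrite ger0_norm ?invf_lt1 ?invr_ge0 // ltr1n.
  have e3 : 0 < e / 3 by rewrite divr_gt0.
  have /cvgrPdist_lt/(_ _ e3)[N _ /(_ N (leqnn N))] := r_cvg.
  rewrite /= sub0r normrN gtr0_norm // => rN; exists N => n m /andP[Nn nm].
  have NB k : (N <= k)%N -> rnorm (s k - s N) <= 3 / 2 * r N.
    by move=> Nk; rewrite -(subnKC Nk).
  apply: le_lt_trans (ler_rnorm_dist _ (s N) _) _; rewrite (rnorm_distC (s N)).
  by move: (NB n Nn) (NB m (leq_trans Nn nm)) rN (r0 N); lra.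
have xs n : rnorm (x - s n) <= 3 / 2 * r n.
  have lim : (fun k => rnorm (s k - s n)) @ \oo --> rnorm (x - s n).
    by apply: cvg_rnorm; apply: cvgB => //; exact: cvg_cst.
  apply: (ler_cvg_to lim (cvg_cst (3 / 2 * r n))); near=> k.
  have nk : (n <= k)%N by near: k; exact: nbhs_infty_ge.
  by rewrite -(subnKC nk).
have xy n : r n * rnorm (y (i n)) <= 2 * rnorm (dot x (y (i n))).
  have := ler_rnormDB (dot (s n.+1) (y (i n))) (dot x (y (i n))).
  rewrite -dotBl => le1; have := sy n.
  have := dot_CS (s n.+1 - x) (y (i n)); rewrite rnorm_distC.
  have : rnorm (x - s n.+1) * rnorm (y (i n)) <= 2^-1 * (r n * rnorm (y (i n))).
    rewrite mulrA ler_wpM2r ?rnorm_ge0 //.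
    by apply: le_trans (xs _) _; rewrite rS; lra.
  by move: le1; lra.
have [M xM] := bnd x.
have [n Mn] : exists n : nat, M <= n%:R.
  by exists (Num.bound `|M|); apply: le_trans (ler_norm M) (ltW (archi_boundP _)).
have := iP n; have := xy n; have := xM (i n).
have : M * w (i n) <= n%:R * w (i n) by rewrite ler_wpM2r.
have -> : r n = (3 ^+ n)^-1 by rewrite /r exprVn.
rewrite ler_pdivrMl ?exprn_gt0 //.
have p3 : 0 < 3 ^+ n :> R by rewrite exprn_gt0.
move=> le1 le2 le3 /lt_le_trans/(_ le3).
have : 3 ^+ n * rnorm (dot x (y (i n))) <= 3 ^+ n * (n%:R * w (i n)).
  by rewrite ler_pM2l // (le_trans le2).
by move: (3 ^+ n) (n%:R : R) => p q; lra.
Unshelve. all: by end_near. Qed.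

(** * Orthonormal bases and adjoints *)

Definition orthonormal_seq h : Prop := forall n k, dot (h n) (h k) = (n == k)%:R.

Lemma rnorm_lincomb_orthonormal h a k : orthonormal_seq h ->
  rnorm (lincomb h a k) ^+ 2 = psum a k.
Proof.
move=> ho; apply: complexI; rewrite rnorm_dot dot_lincombr /psum rmorph_sum /=.
apply: eq_bigr => n _; rewrite (@dot_lincomb_biorth _ _ _ n) /cut ?ltn_ord ?sqr_rnorm //.
by rewrite mulrC.
Qed.

Lemma orthonormal_bessel h : orthonormal_seq h -> bessel 1 h.
Proof. by move=> ho a k; rewrite rnorm_lincomb_orthonormal ?mul1r. Qed.

Lemma closure_span_ortho0 (E : set H) g z : closure (lin_span (range g)) = E ->
  E z -> (forall n, dot (g n) z = 0) -> z = 0.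
Proof.
move=> <- Ez gz; apply/eqP; rewrite -(dnorm_eq0 dot); apply/eqP.
apply: closure_dot0 Ez => x; apply: (lin_span_sub (submod_ortho z)).
by move=> _ [n _ <-]; exact: gz.
Qed.

Section OrthonormalBasis.
Variable h : nat -> H.
Hypothesis hB : orthonormal_basis dot [set: H] h.

Let ho : orthonormal_seq h.
Proof. by case: hB. Qed.

Lemma onb_bessel : bessel 1 h.
Proof. exact: orthonormal_bessel. Qed.

(** The difference of the two sides is orthogonal to every basis vector. *)
Lemma onb_expansion x : mixed h h x = x.
Proof.
apply/eqP; rewrite eq_sym -subr_eq0; apply/eqP.
apply: (closure_span_ortho0 (proj2 hB) Logic.I) => n; apply: dot0C.
by rewrite dotBl (@mixed_biorth _ _ _ _ onb_bessel onb_bessel _ n) ?subrr.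
Qed.

Lemma onb_cvg x : lincomb h (fun n => dot x (h n)) @ \oo --> x.
Proof. by rewrite -{2}(onb_expansion x); apply: mixed_cvg; exact: onb_bessel. Qed.

Lemma parseval x : sqsum (fun n => dot x (h n)) = ((rnorm x ^+ 2)%:E)%E.
Proof.
have x2 := bessel_ell2 x onb_bessel.
rewrite (ell2E x2); congr (_%:E); apply/eqP; rewrite eq_le; apply/andP; split.
  rewrite -lee_fin -ell2E //; apply/sqsum_leP => k.
  by have := bessel_dot x onb_bessel k; rewrite mul1r.
have lim : (fun k => rnorm (lincomb h (fun n => dot x (h n)) k) ^+ 2) @ \oo -->
    rnorm x ^+ 2.
  by rewrite expr2; apply: cvgM; apply: cvg_rnorm; exact: onb_cvg.
apply: (ler_cvg_to lim (cvg_cst _)); near=> k.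
by rewrite rnorm_lincomb_orthonormal // psum_le_ell2.
Unshelve. all: by end_near. Qed.

Section Adjoint.
Variables (B : {linear H -> H}) (M : R).
Hypothesis BM : forall x, rnorm (B x) <= M * rnorm x.

Lemma linear_lincomb g a k : B (lincomb g a k) = lincomb (B \o g) a k.
Proof. by rewrite /lincomb linear_sum; apply: eq_bigr => n _; rewrite linearZ. Qed.

Lemma image_bessel C g : 0 <= M -> bessel C g -> bessel (M ^+ 2 * C) (B \o g).
Proof.
move=> M0 gC a k; rewrite -linear_lincomb -mulrA.
apply: le_trans (_ : M ^+ 2 * rnorm (lincomb g a k) ^+ 2 <= _).
  by rewrite -exprMn ler_pXn2r ?nnegrE ?mulr_ge0 ?rnorm_ge0.
by rewrite ler_wpM2l ?sqr_ge0.
Qed.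

Lemma bounded_linear_cvg (u : nat -> H) x : 0 <= M ->
  u @ \oo --> x -> (fun n => B (u n)) @ \oo --> B x.
Proof.
move=> M0 ux; apply: (@cvg_rnorm_squeeze _ _ _ _ (fun n => M * rnorm (u n - x))).
  by move=> n; rewrite -linearB.
rewrite -(mulr0 M); apply: cvgMr; rewrite -(rnorm0 H) -(subrr x).
by apply: cvg_rnorm; apply: cvgB => //; exact: cvg_cst.
Qed.

Lemma mixed_linearE : 0 <= M -> mixed h (B \o h) =1 B.
Proof.
move=> M0 x; apply: (cvg_lim (@norm_hausdorff _ H)).
have -> : lincomb (B \o h) (fun n => dot x (h n)) =
    (fun k => B (lincomb h (fun n => dot x (h n)) k)).
  by apply/funext => k; rewrite linear_lincomb.
by apply: bounded_linear_cvg => //; exact: onb_cvg.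
Qed.

(** A formula for the adjoint in terms of the basis: since [B] is the cross operator
    of [h] and [B h], exchanging the two sequences gives its adjoint. *)
Definition adjoint : H -> H := mixed (B \o h) h.

Lemma adjointE x y : 0 <= M -> dot (adjoint y) x = dot y (B x).
Proof.
move=> M0; rewrite (mixed_adjoint _ _ (image_bessel M0 onb_bessel) onb_bessel).
by rewrite mixed_linearE.
Qed.

End Adjoint.
End OrthonormalBasis.

Section ExistsOrthonormalBasis.
Hypothesis Hinf : infinite_dim [set: H].

Let residual (s : seq H) x := x - \sum_(v <- s) dot x v *: v.

Let residual_ortho s x u : orthonormal dot s -> u \in s -> dot (residual s x) u = 0.
Proof.
move=> /orthonormalP[us so] su; rewrite dotBl dot_suml.
rewrite (bigD1_seq u) //= dotZl (so u u) // eqxx mulr1 big_seq_cond big1 ?addr0 ?subrr //.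
by move=> v /andP[sv /negPf vu]; rewrite dotZl (so v u) // vu mulr0.
Qed.

Let sum_span (s : seq H) (F : H -> R[i]) (S : set H) :
  (forall v, v \in s -> S v) -> lin_span S (\sum_(v <- s) F v *: v).
Proof.
move=> sS; exists (size s), (fun i => F s`_i), (fun i => s`_i).
by split=> [i|]; [exact/sS/mem_nth|rewrite (big_nth 0) big_mkord].
Qed.

(** One Gram-Schmidt step.  If [x] already lies in the span of [s], any vector
    outside of that span provides the direction of [v] instead. *)
Let gram_schmidt_step s x : exists v, orthonormal dot s ->
  orthonormal dot (v :: s) /\ lin_span [set` v :: s] x.
Proof.
have [so|/negP nso] := boolP (orthonormal dot s); last by exists 0.
have [y yN0 xy] : exists2 y, residual s y != 0 & residual s x != 0 -> y = x.
  have [x0|xN0] := eqVneq (residual s x) 0; last by exists x.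
  apply: contrapT => nex; apply: (Hinf (s := s)) => y _.
  have -> : y = \sum_(v <- s) dot y v *: v.
    apply/eqP; rewrite -subr_eq0; apply/negPn/negP => yN0.
    by apply: nex; exists y => //; rewrite x0 eqxx.
  exact: sum_span.
have ny : 0 < rnorm (residual s y).
  by rewrite lt_def rnorm_ge0 andbT; apply: contra_neq yN0 => /rnorm0_eq0.
pose v := ((rnorm (residual s y))^-1%:C)%C *: residual s y.
have rv : residual s y = ((rnorm (residual s y))%:C)%C *: v.
  by rewrite scalerA -rmorphM divff ?gt_eqF // scale1r.
have vs u : u \in s -> dot v u = 0.
  by move=> su; rewrite dotZl residual_ortho // mulr0.
have vv : dot v v = 1.
  rewrite -rnorm_dot rnormZ rnormC_ge0 ?invr_ge0 ?rnorm_ge0 //.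
  by rewrite mulVf ?gt_eqF // expr1n.
have vso : orthonormal dot (v :: s).
  have /orthonormalP[us ss] := so; apply/orthonormalP; split=> [|u w].
    rewrite /= us andbT; apply/negP => /vs; rewrite vv => /eqP.
    by rewrite oner_eq0.
  have neq t : t \in s -> (t == v) = false.
    move=> ts; apply/negP => /eqP tv; have := vs _ ts; rewrite tv vv.
    by move/eqP; rewrite oner_eq0.
  rewrite !inE => /orP[/eqP->|us'] /orP[/eqP->|ws'].
  - by rewrite vv eqxx.
  - by rewrite vs // eq_sym neq.
  - by rewrite (dot0C (vs _ us')) neq.
  - exact: ss.
exists v => _; split => //.
have -> : x = \sum_(u <- v :: s) (if u == v then dot x v else dot x u) *: u.
  rewrite big_cons eqxx.
  have -> : \sum_(u <- s) (if u == v then dot x v else dot x u) *: u =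
            \sum_(u <- s) dot x u *: u.
    by apply: eq_bigr => u _; case: eqP => [->|].
  apply/eqP; rewrite -subr_eq -/(residual s x); apply/eqP.
  have vsum t : dot (\sum_(u <- s) dot t u *: u) v = 0.
    rewrite dot_suml big_seq big1 // => u su.
    by rewrite dotZl (dot0C (vs _ su)) mulr0.
  have xE : x = residual s x + \sum_(u <- s) dot x u *: u by rewrite subrK.
  have [x0|/xy yx] := eqVneq (residual s x) 0.
    by rewrite {2}xE dotDl vsum x0 dot0l addr0 scale0r.
  by rewrite {2}xE dotDl vsum addr0 -yx rv dotZl vv mulr1.
exact: sum_span.
Qed.

(** Gram-Schmidt along an enumeration [d] of a dense set: [s n] lists the first [n]
    basis vectors in reverse order, and [d n] lies in the span of [s n.+1]. *)
Lemma exists_onb : separable_space H -> exists h, orthonormal_basis dot [set: H] h.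
Proof.
case=> S Sc Sd.
have [d dS] : exists d : nat -> H, S `<=` range d.
  have /countable_injP[f fI] := Sc.
  exists (fun n => xget 0 [set x | S x /\ f x = n]) => x Sx; exists (f x) => //.
  case: xgetP => [y _ [Sy fyx]|/(_ x)[]//].
  by apply: fI; rewrite ?inE.
have /choice[step stepP] (ns : nat * seq H) := gram_schmidt_step ns.2 (d ns.1).
pose fix s n : seq H := if n is m.+1 then step (m, s m) :: s m else [::].
have so n : orthonormal dot (s n).
  by elim: n => [//|n IH]; have [] := stepP (n, s n) IH.
pose h n := step (n, s n).
have sE n v : v \in s n -> exists2 k, (k < n)%N & v = h k.
  elim: n => [//|n IH]; rewrite inE => /orP[/eqP->|/IH[k kn ->]]; first by exists n.
  by exists k => //; exact: ltnW.
have hs k n : (k < n)%N -> h k \in s n.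
  elim: n => [//|n IH]; rewrite ltnS leq_eqVlt => /orP[/eqP->|/IH kn].
    by rewrite inE eqxx.
  by rewrite inE kn orbT.
exists h; split=> [n k|].
  have /orthonormalP[us ss] := so (maxn n k).+1.
  rewrite ss ?hs ?ltnS ?leq_maxl ?leq_maxr //; congr (_%:R); congr nat_of_bool.
  have hN m l : (m < l)%N -> (h m == h l) = false.
    move=> ml; apply/negP => /eqP e; have := so l.+1 => /orthonormalP[/= /andP[]].
    by rewrite -[step _]/(h l) -e (hs _ _ ml).
  by case: (ltngtP n k) => [/hN //|/hN|->]; rewrite ?eqxx // eq_sym.
apply/seteqP; split=> // x _; apply/closure_rnormP => e e0.
have [||y [xy Sy]] := Sd (ball x (e%:C)%C).
- by exists x; apply: ballxx; rewrite ltcR.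
- by apply: ball_open; rewrite ltcR.
have [n _ ny] := dS y Sy.
exists y; last by move: xy; rewrite -ball_normE /ball_ /= -rnormE ltcR.
have [_ [k [a [v [vs yE]]]]] := stepP (n, s n) (so n).
exists k, a, v; split=> [i|]; last by rewrite -ny.
by have [m _ ->] := sE n.+1 (v i) (vs i); exists m.
Qed.

End ExistsOrthonormalBasis.

(** * Square roots of positive operators *)

(** Since [A = 1 - P/C] is a contraction, the iteration [Y' = (A + Y^2)/2] from 0
    converges to a solution [T] of [T^2 = 2 T - A], so that [(1 - T)^2 = 1 - A = P/C] and
    [sqrt C (1 - T)] is the desired root.  Convergence is pointwise but with a
    rate proportional to [|x|], given by the scalar iteration [y' = (1 + y^2)/2]. *)
Section SquareRoot.
Variables (P : {linear H -> H}) (C : R).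
Hypotheses (C0 : 0 < C) (Psym : is_adjoint dot dot P P).
Hypothesis PC : forall x, rnorm (P x) ^+ 2 <= C * complex.Re (dot (P x) x).

Let A x : H := x - (C^-1%:C)%C *: P x.

Let A_linear c x y : A (c *: x + y) = c *: A x + A y.
Proof.
rewrite /A linearP !scalerDr opprD addrACA scalerN !scalerA.
by rewrite [_ * c]mulrC.
Qed.

Let A_sym x y : dot (A x) y = dot x (A y).
Proof. by rewrite dotBl dotBr dotZl dotZr conjC_real Psym. Qed.

(** This is where the hypothesis on [P] enters:
    [|Ax|^2 = |x|^2 - 2 <Px,x>/C + |Px|^2/C^2 <= |x|^2 - <Px,x>/C]. *)
Let A_le x : rnorm (A x) <= rnorm x.
Proof.
rewrite -(@ler_pXn2r _ 2) ?nnegrE ?rnorm_ge0 //.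
set p := complex.Re (dot (P x) x); have p0 : 0 <= p.
  by rewrite -(pmulr_rge0 _ C0); apply: le_trans (PC x); exact: sqr_ge0.
have -> : rnorm (A x) ^+ 2 = rnorm x ^+ 2 - 2 * (C^-1 * p) +
    C^-1 ^+ 2 * rnorm (P x) ^+ 2.
  rewrite rnormE_dot dotBl !dotBr !dotZl !dotZr conjC_real -Psym.
  rewrite !(raddfB, raddfD, raddfN) /= !ReZ -!rnormE_dot -/p; ring.
have : C^-1 ^+ 2 * rnorm (P x) ^+ 2 <= C^-1 * p.
  rewrite -[leRHS]mul1r -(mulVf (lt0r_neq0 C0)).
  have -> : C^-1 * C * (C^-1 * p) = C^-1 ^+ 2 * (C * p) by ring.
  by rewrite ler_wpM2l ?sqr_ge0 // PC.
have : 0 <= C^-1 * p by rewrite mulr_ge0 // invr_ge0 ltW.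
lra.
Qed.

Let Y := fix Y n x : H := if n is m.+1 then 2^-1 *: (A x + Y m (Y m x)) else 0.
Let y := fix y n : R := if n is m.+1 then 2^-1 * (1 + y m ^+ 2) else 0.

Let rnorm_half x : rnorm ((2^-1 : R[i]) *: x) = 2^-1 * rnorm x.
Proof.
have -> : (2^-1 : R[i]) = ((2^-1 : R)%:C)%C by rewrite fmorphV rmorphD.
by rewrite rnormZ rnormC_ge0 // invr_ge0.
Qed.

Let Y_linear n c x z : Y n (c *: x + z) = c *: Y n x + Y n z.
Proof.
elim: n c x z => [|n IH] c x z /=; first by rewrite scaler0 addr0.
by rewrite !IH A_linear addrACA -scalerDr [LHS]scalerDr !scalerA mulrC.
Qed.

Let YB n x z : Y n (x - z) = Y n x - Y n z.
Proof. by rewrite addrC -scaleN1r Y_linear scaleN1r addrC. Qed.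

Let YD n x z : Y n (x + z) = Y n x + Y n z.
Proof. by rewrite -[x]scale1r Y_linear !scale1r. Qed.

Let YZ n c x : Y n (c *: x) = c *: Y n x.
Proof. by rewrite -[c *: x]addr0 Y_linear -(subrr 0) YB subrr addr0. Qed.

Let AY n x : A (Y n x) = Y n (A x).
Proof.
elim: n x => [|n IH] x /=.
  by rewrite /A linear0 scaler0 subrr.
have AD u v : A (u + v) = A u + A v by rewrite -[u]scale1r A_linear !scale1r.
rewrite -!IH -AD -[2^-1 *: _]addr0 A_linear.
by rewrite /A linear0 scaler0 subrr addr0.
Qed.

Let Y_comm m n x : Y m (Y n x) = Y n (Y m x).
Proof.
elim: m x => [|m IH] x; last by rewrite /= YZ YD AY !IH.
by rewrite /= -(scale0r (0 : H)) YZ !scale0r.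
Qed.

Let Y_sym n x z : dot (Y n x) z = dot x (Y n z).
Proof.
elim: n x z => [|n IH] x z /=; first by rewrite dot0l dot0r.
have -> : (2^-1 : R[i]) = ((2^-1 : R)%:C)%C by rewrite fmorphV rmorphD.
by rewrite dotZl dotZr conjC_real dotDl dotDr A_sym !IH.
Qed.

Let y_bound n : 0 <= y n <= 1.
Proof.
elim: n => [|n /andP[y0 y1]] /=; first by rewrite lexx ler01.
have : y n ^+ 2 <= 1 by rewrite expr_le1.
by have := sqr_ge0 (y n); move=> ? ?; apply/andP; split; lra.
Qed.

Let y_ge0 n : 0 <= y n. Proof. by have /andP[] := y_bound n. Qed.
Let y_le1 n : y n <= 1. Proof. by have /andP[] := y_bound n. Qed.

Let y_homo : {homo y : m n / (m <= n)%N >-> m <= n}.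
Proof.
apply: homo_leq => [//|a b c|n /=]; first exact: le_trans.
have := sqr_ge0 (1 - y n); rewrite sqrrB expr1n mul1r mulr2n; lra.
Qed.

Let Y_le n x : rnorm (Y n x) <= y n * rnorm x.
Proof.
elim: n x => [|n IH] x /=; first by rewrite rnorm0 mul0r.
rewrite rnorm_half -mulrA ler_wpM2l ?invr_ge0 //.
apply: le_trans (ler_rnormD _ _) _; rewrite mulrDl mul1r lerD //.
apply: le_trans (IH _) _; rewrite expr2 -mulrA ler_wpM2l //.
Qed.

(** [Y_(n+2) - Y_(n+1) = (Y_(n+1) + Y_n) (Y_(n+1) - Y_n) / 2] because the
    iterates commute, so the scalar iteration majorizes the operator one. *)
Let Y_step n x : rnorm (Y n.+1 x - Y n x) <= (y n.+1 - y n) * rnorm x.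
Proof.
have YS m z : Y m.+1 z = 2^-1 *: (A z + Y m (Y m z)) by [].
elim: n x => [|n IH] x.
  rewrite [Y 1 x]/= [Y 0 x]/= [y 1]/= [y 0]/= addr0 subr0 rnorm_half.
  by rewrite expr0n /= addr0 mulr1 subr0 ler_wpM2l ?invr_ge0.
set d := Y n.+1 x - Y n x.
have -> : Y n.+2 x - Y n.+1 x = 2^-1 *: (Y n.+1 d + Y n d).
  rewrite (YS n.+1) [X in _ - X]YS -scalerBr opprD addrACA subrr add0r.
  by rewrite /d !YB (Y_comm n.+1 n) addrA subrK.
rewrite rnorm_half.
have -> : y n.+2 - y n.+1 = 2^-1 * ((y n.+1 + y n) * (y n.+1 - y n)).
  have yS m : y m.+1 = 2^-1 * (1 + y m ^+ 2) by [].
  by rewrite (yS n.+1) [X in _ - X = _]yS; ring.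
rewrite -!mulrA ler_wpM2l ?invr_ge0 //.
apply: le_trans (ler_rnormD _ _) _; rewrite mulrDl.
by apply: lerD; (apply: le_trans (Y_le _ _) _); rewrite ler_wpM2l //; exact: IH.
Qed.

Let Y_diff n m x : (n <= m)%N -> rnorm (Y m x - Y n x) <= (y m - y n) * rnorm x.
Proof.
elim: m => [|m IH]; first by rewrite leqn0 => /eqP->; rewrite !subrr rnorm0 mul0r.
rewrite leq_eqVlt => /orP[/eqP->|/IH nm]; first by rewrite !subrr rnorm0 mul0r.
apply: le_trans (ler_rnorm_dist _ (Y m x) _) _.
by have := Y_step m x; move: nm; rewrite !mulrBl; lra.
Qed.

Let T x : H := limn (Y ^~ x).

Let T_cvg x : Y ^~ x @ \oo --> T x.
Proof.
apply: rnorm_cauchy => e e0.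
have x1 : 0 < rnorm x + 1 by rewrite ltr_wpDl // rnorm_ge0.
have y_cvg : cvgn y.
  apply: nondecreasing_is_cvgn => //.
  by exists 1 => _ [n _ <-]; exact: y_le1.
set l := limn y in y_cvg.
have yl n : y n <= l by apply: nondecreasing_cvgn_le.
have : y @ \oo --> l by [].
move=> /cvgrPdist_lt/(_ _ (divr_gt0 e0 x1))[N _ yN].
exists N => n m /andP[Nn nm]; have := yN n Nn.
rewrite ger0_norm ?subr_ge0 // ltr_pdivlMr //.
apply: le_lt_trans; apply: le_trans (Y_diff x nm) _.
apply: ler_pM; rewrite ?rnorm_ge0 ?subr_ge0 ?y_homo ?lerDl //.
by rewrite lerB.
Qed.

Let T_linear : linear T.
Proof.
move=> c x z; apply: (cvg_lim (@norm_hausdorff _ H)).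
have -> : Y ^~ (c *: x + z) = (fun n => c *: Y n x + Y n z).
  by apply/funext => n; rewrite Y_linear.
by apply: cvgD; [apply: cvgZr|]; exact: T_cvg.
Qed.

Let T_sym x z : dot (T x) z = dot x (T z).
Proof. by apply: (dot_cvg_adjoint (@T_cvg x) (@T_cvg z)) => n; exact: Y_sym. Qed.

Let T_le x : rnorm (T x) <= rnorm x.
Proof.
apply: (ler_cvg_to (cvg_rnorm (@T_cvg x)) (cvg_cst (rnorm x))); near=> n.
apply: le_trans (Y_le _ _) _; rewrite -[leRHS]mul1r ler_wpM2r ?rnorm_ge0 //.
Unshelve. all: by end_near. Qed.

Let T_fixpoint x : T (T x) = 2 *: T x - A x.
Proof.
have YY : (fun n => Y n (Y n x)) @ \oo --> T (T x).
  pose s n := rnorm (Y n x - T x) + rnorm (Y n (T x) - T (T x)).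
  apply: (@cvg_rnorm_squeeze _ _ _ _ s) => [n|].
    apply: le_trans (ler_rnorm_dist _ (Y n (T x)) _) _; rewrite lerD2r -YB.
    apply: le_trans (Y_le _ _) _; rewrite -[leRHS]mul1r ler_wpM2r ?rnorm_ge0 //.
  have lim z : (fun n => rnorm (Y n z - T z)) @ \oo --> 0.
    rewrite -(rnorm0 H) -(subrr (T z)); apply: cvg_rnorm.
    by apply: cvgB; [exact: T_cvg|exact: cvg_cst].
  by rewrite -(addr0 0); apply: cvgD; exact: lim.
have lim1 : (fun n => Y n.+1 x) @ \oo --> 2^-1 *: (A x + T (T x)).
  by apply: cvgZr; apply: cvgD => //; exact: cvg_cst.
have lim2 : (fun n => Y n.+1 x) @ \oo --> T x.
  by have := @T_cvg x; rewrite -(@cvg_shiftS _ (Y ^~ x)).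
have TE : T x = 2^-1 *: (A x + T (T x)).
  exact: (cvg_unique (@norm_hausdorff _ H) lim2 lim1).
by rewrite [X in 2 *: X]TE scalerA divff ?pnatr_eq0 // scale1r addrC addKr.
Qed.

Lemma exists_positive_sqrt : exists S : {linear H -> H}, is_positive_sqrt dot P S.
Proof.
pose r : R[i] := ((Num.sqrt C)%:C)%C.
pose F x : H := r *: (x - T x).
have F_linear : linear F.
  move=> c x z; rewrite /F T_linear opprD addrACA scalerDr !scalerBr !scalerA.
  by rewrite mulrC.
pose S : {linear H -> H} := HB.pack F (GRing.isLinear.Build _ _ _ _ F F_linear).
have S_sym : is_adjoint dot dot S S.
  by move=> x z; rewrite /= dotZl dotZr conjC_real dotBl dotBr T_sym.
exists S; split=> //.
- exists (Num.sqrt C * 2) => x; rewrite /= rnormZ rnormC_ge0 ?sqrtr_ge0 //.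
  rewrite -mulrA ler_wpM2l ?sqrtr_ge0 //; apply: le_trans (ler_rnormB _ _) _.
  by have := T_le x; lra.
- move=> x; have /complex_realP[t tE] : dot (S x) x \is Num.real.
    by apply/CrealP; rewrite -dotC S_sym.
  rewrite tE (_ : 0 = (0%:C)%C) // lecR.
  have -> : t = Num.sqrt C * complex.Re (dot (x - T x) x).
    by rewrite -ReZ -dotZl -/(F x) -/(S x) tE.
  rewrite mulr_ge0 ?sqrtr_ge0 // dotBl raddfB /= -rnormE_dot subr_ge0.
  apply: le_trans (ler_Re_rnorm _) _; apply: le_trans (dot_CS _ _) _.
  by rewrite expr2 ler_wpM2r ?rnorm_ge0.
- move=> x; rewrite /= /F.
  have TZ c z : T (c *: z) = c *: T z.
    have T0 : T 0 = 0.
      by apply: rnorm0_eq0; apply/eqP; rewrite eq_le rnorm_ge0 andbT -(rnorm0 H).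
    by rewrite -[_ *: z]addr0 T_linear T0 addr0.
  have TB u v : T (u - v) = T u - T v.
    by rewrite addrC -scaleN1r T_linear scaleN1r addrC.
  rewrite TZ TB T_fixpoint -scalerBr scalerA -rmorphM -expr2 sqr_sqrtr ?ltW //.
  have -> : x - T x - (T x - (2 *: T x - A x)) = (C^-1%:C)%C *: P x.
    rewrite -[2]/(1 + 1) scalerDl scale1r opprB [_ - A x - T x]addrAC addrK.
    by rewrite addrA subrK /A subKr.
  by rewrite scalerA -rmorphM divff ?gt_eqF // scale1r.
Qed.

End SquareRoot.

(** * Dual Bessel sequences *)

Definition biorthogonal f g : Prop := forall n k, dot (f n) (g k) = (n == k)%:R.

Lemma biorthogonalC f g : biorthogonal f g -> biorthogonal g f.
Proof. by move=> fg n k; rewrite dotC fg conjC_nat eq_sym. Qed.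

(** If [D] were spanned by [m] vectors, the identity matrix [(<g n, f k>)] of size
    [m + 1] would factor through dimension [m]. *)
Lemma biorthogonal_infinite_dim (D : set H) f g :
  biorthogonal f g -> (forall n, D (g n)) -> infinite_dim D.
Proof.
move=> /biorthogonalC gf Dg s Ds.
(* Coordinates with respect to the list [s], which may be dependent. *)
have coord : lin_span [set` s] `<=`
    [set x | exists c : 'rV[R[i]]_(size s), x = \sum_j c 0 j *: s`_j].
  apply: lin_span_sub => [|v /= vs].
    apply/submodP; split=> [|a _ _ [c ->] [d ->]].
      by exists 0; rewrite big1 // => j _; rewrite mxE scale0r.
    exists (a *: c + d); rewrite scaler_sumr -big_split /=; apply: eq_bigr => j _.
    by rewrite !mxE scalerDl scalerA.
  have iv : (index v s < size s)%N by rewrite index_mem.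
  exists (delta_mx 0 (Ordinal iv)); rewrite (bigD1 (Ordinal iv)) //= big1 => [|j].
    by rewrite mxE !eqxx scale1r addr0 nth_index.
  by move=> /negPf jv; rewrite mxE eqxx jv scale0r.
have /choice[c cE] (n : 'I_(size s).+1) :
    exists c : 'rV[R[i]]_(size s), g n = \sum_j c 0 j *: s`_j.
  by apply: coord; apply: Ds.
pose M := \matrix_(n < (size s).+1, j < size s) c n 0 j.
pose N := \matrix_(j < size s, k < (size s).+1) dot s`_j (f k).
have MN : M *m N = 1%:M.
  apply/matrixP => n k; rewrite !mxE -[RHS](gf n k) cE dot_suml.
  by apply: eq_bigr => j _; rewrite !mxE dotZl.
have := mxrankM_maxl M N; rewrite MN mxrank1 => /leq_trans/(_ (rank_leq_col M)).
by rewrite ltnn.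
Qed.

Definition has_dual f : Prop := exists C g, [/\ 0 < C, bessel C g & biorthogonal f g].

Lemma Riesz_FischerP f : Riesz_Fischer_sequence f <->
  exists2 c : R, 0 < c & forall a k, c * psum a k <= rnorm (lincomb f a k) ^+ 2.
Proof.
split=> [] [c c0 fc]; exists c => //; last by move=> k a; exact: fc.
by move=> a [|k]; [rewrite /psum big_ord0 mulr0 sqr_ge0|exact: fc].
Qed.

(** Pairing [sum a_n f_n] with [sum a_n g_n] gives [sum |a_n|^2]. *)
Lemma dual_Riesz_Fischer f : has_dual f -> Riesz_Fischer_sequence f.
Proof.
case=> C [g [C0 gC fg]]; apply/Riesz_FischerP.
exists C^-1 => [|a k]; first by rewrite invr_gt0.
rewrite ler_pdivrMl //; set s := psum a k.
have sE : dot (lincomb f a k) (lincomb g a k) = (s%:C)%C.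
  rewrite dot_lincombr /s /psum rmorph_sum; apply: eq_bigr => n _ /=.
  rewrite (@dot_lincomb_biorth _ _ _ n) => [|m]; last exact: fg.
  by rewrite /cut ltn_ord sqr_rnorm mulrC.
have s0 : 0 <= s := psum_ge0 _ _.
have [->|sN0] := eqVneq s 0; first by rewrite mulr_ge0 ?sqr_ge0 // ltW.
have sp : 0 < s by rewrite lt_def sN0.
have := dot_CS (lincomb f a k) (lincomb g a k); rewrite sE rnormC_ge0 // => CS.
rewrite -(ler_pM2r sp) -expr2.
apply: le_trans (_ : (rnorm (lincomb f a k) * rnorm (lincomb g a k)) ^+ 2 <= _).
  by rewrite ler_pXn2r // ?nnegrE ?mulr_ge0 ?rnorm_ge0.
by rewrite exprMn [C * _]mulrC -[leRHS]mulrA ler_wpM2l ?sqr_ge0 // gC.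
Qed.

Lemma dual_span_bound C f g x : bessel C g -> biorthogonal f g ->
  lin_span (range g) x -> rnorm x ^+ 2 <= C * fine (sqsum (analysis_op dot f x)) /\
    ell2 R (analysis_op dot f x).
Proof.
move=> gC fg; rewrite lin_spanE => -[a [k ->]].
have -> : analysis_op dot f (lincomb g a k) = cut k a.
  apply/funext => n; apply: dot_lincomb_biorth => m; exact: biorthogonalC.
by rewrite /ell2 /= sqsum_cut ltry; split=> //; exact: gC.
Qed.

Lemma dual_bounded_below f : has_dual f ->
  exists D : set H, bounded_below_biorthogonal dot f D.
Proof.
case=> C [g [C0 gC fg]]; exists (lin_span (range g)).
have Dg n : lin_span (range g) (g n) by exact: lin_span_gen.
split; [exact: lin_span_submod|exact: biorthogonal_infinite_dim fg Dg| |by exists g].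
exists C^-1 => [|x /(dual_span_bound gC fg)[xC x2]]; first by rewrite invr_gt0.
by apply/andP; split=> //; rewrite (ell2E x2) lee_fin ler_pdivrMl.
Qed.

Lemma dual_surjective f : has_dual f ->
  set_surj (analysis_dom dot f) (ell2 R) (analysis_op dot f).
Proof.
case=> C [g [C0 gC fg]] a a2; exists (synth g a).
  rewrite /analysis_dom /=; suff -> : analysis_op dot f (synth g a) = a by [].
  apply/funext => n; apply: synth_biorth gC a2 _ => m; exact: biorthogonalC.
apply/funext => n; apply: synth_biorth gC a2 _ => m; exact: biorthogonalC.
Qed.

(** A bounded below subspace consists of limits of combinations of its dual
    sequence: removing the first terms of the expansion of a vector of [D] cuts
    its analysis coefficients down to a tail, which controls the norm. *)
Lemma bounded_below_dual f (D : set H) : bounded_below_biorthogonal dot f D ->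
  exists C g, [/\ 0 < C, bessel C g, biorthogonal f g, (forall n, D (g n)) &
    D `<=` closure (lin_span (range g))].
Proof.
case=> Dsub _ [A A0 DA] [g Dg fg]; exists A^-1, g.
have gf := biorthogonalC fg.
have gk a k : analysis_op dot f (lincomb g a k) = cut k a.
  by apply/funext => n; exact: dot_lincomb_biorth.
have DA' x : D x -> A * rnorm x ^+ 2 <= fine (sqsum (analysis_op dot f x)) /\
    ell2 R (analysis_op dot f x).
  by move=> /DA/andP[Ax x2]; split=> //; rewrite -lee_fin -(ell2E x2).
split=> // [|a k|x Dx].
- by rewrite invr_gt0.
- have [] := DA' _ (submod_lincomb Dsub Dg a k).
  by rewrite gk sqsum_cut /= ler_pdivlMl.
have [_ x2] := DA' x Dx; set a := analysis_op dot f x in x2.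
apply/closure_rnormP => e e0.
have Ae : 0 < A * e ^+ 2 / 2 by rewrite divr_gt0 // mulr_gt0 // exprn_gt0.
have [N Na] := sqsum_tail_cvg x2 Ae.
exists (lincomb g a N); first exact: lin_span_lincomb.
have [|] := DA' (x - lincomb g a N).
  have /submodP[_ DP] := Dsub.
  by rewrite addrC -scaleN1r; apply: DP => //; exact: submod_lincomb.
have -> : analysis_op dot f (x - lincomb g a N) = tail N a.
  apply/funext => n; rewrite /analysis_op dotBl.
  rewrite -[dot (lincomb _ _ _) _]/(analysis_op dot f _ n).
  by rewrite gk /cut /tail -/(a n); case: ifP; rewrite ?subrr ?subr0.
move=> xN t2; have := Na N (leqnn N); rewrite (ell2E t2) lee_fin => /(le_trans xN) le.
rewrite -(@ltr_pXn2r _ 2) ?nnegrE ?rnorm_ge0 ?(ltW e0) //.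
by rewrite -(ltr_pM2l A0); apply: le_lt_trans le _; move: Ae; lra.
Qed.

(** The vector [g n] is the component of [f n] orthogonal to the other vectors of
    [f], rescaled; the Riesz-Fischer inequality keeps that component away from
    0.  Since [g] lies in the closed span of [f], the norm of a combination of
    [g] can be tested against the span of [f], where the inequality applies. *)
Lemma Riesz_Fischer_dual f : Riesz_Fischer_sequence f -> has_dual f.
Proof.
move=> /Riesz_FischerP[c c0 fc].
pose f' n m := if m == n then 0 else f m.
have dist n d : lin_span (range (f' n)) d -> c <= rnorm (f n - d) ^+ 2.
  rewrite lin_spanE => -[a [k ->]].
  (* [f n - d] is itself a combination of [f], with coefficient 1 at [n]. *)
  pose b m := if m == n then 1 else - cut k a m; pose K := maxn k n.+1.
  have nK : (n < K)%N by rewrite /K leq_max ltnSn orbT.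
  have -> : f n - lincomb (f' n) a k = lincomb f b K.
    rewrite -(lincomb_delta f nK) -(lincomb_cut _ _ (leq_maxl k n.+1)).
    rewrite /lincomb -sumrB; apply: eq_bigr => m _; rewrite /delta /b /f'.
    by case: eqP => _; rewrite ?scaler0 ?subr0 // scale0r sub0r scaleNr.
  apply: le_trans (fc b K); rewrite -[leLHS]mulr1 ler_pM2l // /psum.
  rewrite (bigD1 (Ordinal nK)) //= /b eqxx rnorm1 expr1n lerDl.
  by apply: sumr_ge0 => m _; exact: sqr_ge0.
have f'f n : lin_span (range (f' n)) `<=` lin_span (range f).
  apply: lin_span_sub (lin_span_submod f) _ => _ [m _ <-]; rewrite /f'.
  case: eqP => _; last exact: lin_span_gen.
  by have /submodP[] := lin_span_submod f.
have /choice[q qP] n : exists q, [/\ closure (lin_span (range f)) q,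
    dot (f n) q != 0 & forall m, m != n -> dot (f m) q = 0].
  have [p Dp pO] := orth_projection (f n) (lin_span_submod (f' n)).
  have pq : dot p (f n - p) = 0.
    by apply: closure_dot0 Dp => d /pO /dot0C.
  have fq : dot (f n) (f n - p) = ((rnorm (f n - p) ^+ 2)%:C)%C.
    by rewrite rnorm_dot [in RHS]dotBl pq subr0.
  exists (f n - p); split=> [||m /negPf mn].
  - have /submodP[_ DP] := submod_closure (lin_span_submod f).
    rewrite addrC -scaleN1r; apply: DP; first exact: closure_subset (f'f n) _ Dp.
    by apply: subset_closure; exact: lin_span_gen.
  - rewrite fq; have [u Du up] := closure_cvgP Dp.
    have lim : (fun k => rnorm (f n - u k) ^+ 2) @ \oo --> rnorm (f n - p) ^+ 2.
      rewrite !expr2; have : (fun k => rnorm (f n - u k)) @ \oo --> rnorm (f n - p).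
        by apply: cvg_rnorm; apply: cvgB => //; exact: cvg_cst.
      by move=> ?; apply: cvgM.
    have cle : c <= rnorm (f n - p) ^+ 2.
      by apply: (ler_cvg_to (cvg_cst c) lim); near=> k; exact: dist.
    rewrite (_ : 0 = (0%:C)%C) // (inj_eq (@complexI R)) gt_eqF //.
    exact: lt_le_trans cle.
  - apply: dot0C; have -> : f m = f' n m by rewrite /f' mn.
    by apply: pO; exact: lin_span_gen.
pose g n := (Num.conj (dot (f n) (q n)))^-1 *: q n.
have fg : biorthogonal f g.
  move=> n k; have [_ qk qO] := qP k; rewrite dotZr fmorphV /= conjCK.
  by have [->|/qO ->] := eqVneq n k; rewrite ?mulr0 ?mulVf.
have gf := biorthogonalC fg.
have spang := submod_lincomb (submod_closure (lin_span_submod f)) (g := g).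
have Dg n : closure (lin_span (range f)) (g n).
  have [Dq _ _] := qP n; have /submodP[D0 DP] := submod_closure (lin_span_submod f).
  by rewrite /g -[_ *: _]addr0; exact: DP.
exists c^-1, g; split=> // [|b k]; first by rewrite invr_gt0.
set z := lincomb g b k; have Dz : closure (lin_span (range f)) z by exact: spang.
pose t := Num.sqrt (c^-1 * psum b k).
have t0 : 0 <= c^-1 * psum b k by rewrite mulr_ge0 ?psum_ge0 // invr_ge0 ltW.
have zt : rnorm (dot z z) <= t * rnorm z.
  apply: closure_dot_le Dz => y; rewrite lin_spanE => -[a [K ->]].
  have -> : dot (lincomb f a K) z = \sum_(n < k) cut K a n * Num.conj (b n).
    rewrite /z dot_lincombr; apply: eq_bigr => n _; rewrite mulrC.
    by rewrite (@dot_lincomb_biorth _ _ _ n).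
  rewrite -(@ler_pXn2r _ 2) ?nnegrE ?mulr_ge0 ?sqrtr_ge0 ?rnorm_ge0 //.
  apply: le_trans (psum_CS _ _ _) _; rewrite exprMn sqr_sqrtr //.
  rewrite mulrC -mulrA mulrCA ler_wpM2l ?psum_ge0 // ler_pdivlMl //.
  apply: le_trans (fc a K); rewrite ler_pM2l // psum_cut psum_homo //.
  exact: geq_minl.
rewrite -[leRHS]sqr_sqrtr // -/t ler_pXn2r ?nnegrE ?rnorm_ge0 ?sqrtr_ge0 //.
have [->|z0] := eqVneq (rnorm z) 0; first exact: sqrtr_ge0.
have zp : 0 < rnorm z by rewrite lt_def z0 rnorm_ge0.
move: zt; rewrite -rnorm_dot rnormC_ge0 ?sqr_ge0 // expr2.
by rewrite ler_pM2r.
Unshelve. all: by end_near. Qed.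

(** * From dual sequences to orthonormalizers, and back *)

Section Orthonormalizers.
Variables (f h : nat -> H).
Hypothesis hB : orthonormal_basis dot [set: H] h.
Let h1 : bessel 1 h := onb_bessel hB.

Lemma dual_orthonormalizer C g (gC : bessel C g) : biorthogonal f g ->
  orthonormalizer dot f (mixed_op gC h1).
Proof.
move=> fg; split; first exact: mixed_bounded.
have -> : mixed_op gC h1 \o f = h.
  by apply/funext => n; apply: mixed_dual => m; rewrite fg eq_sym.
exact: hB.
Qed.

Lemma dual_CO : has_dual f -> CO_sequence dot f.
Proof.
by case=> C [g [_ gC fg]]; exists (mixed_op gC h1); exact: dual_orthonormalizer.
Qed.

(** Surjectivity onto square-summable sequences says that, for every [z], the
    functional [<z, .>] transported to the combinations of [f] is represented by
    some vector [x], hence is bounded by [|x|]. *)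
Lemma surjective_Riesz_Fischer :
  set_surj (analysis_dom dot f) (ell2 R) (analysis_op dot f) ->
  Riesz_Fischer_sequence f.
Proof.
move=> surj; apply/Riesz_FischerP.
have [//||K K0 Kh] := @uniform_boundedness ((nat -> R[i]) * nat)
    (fun p => lincomb h p.1 p.2) (fun p => rnorm (lincomb f p.1 p.2)).
- by move=> p; exact: rnorm_ge0.
- move=> z; have [x _ xz] := surj _ (bessel_ell2 z h1).
  exists (rnorm x) => -[a k] /=.
  suff -> : dot z (lincomb h a k) = dot x (lincomb f a k) by exact: dot_CS.
  rewrite !dot_lincombr; apply: eq_bigr => n _.
  by rewrite -[dot x (f n)]/(analysis_op dot f x n) xz.
exists (K ^+ 2)^-1 => [|a k]; first by rewrite invr_gt0 exprn_gt0.
rewrite ler_pdivrMl ?exprn_gt0 // -exprMn -(rnorm_lincomb_orthonormal a k (proj1 hB)).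
by rewrite ler_pXn2r ?nnegrE ?mulr_ge0 ?rnorm_ge0 ?(ltW K0) // (Kh (a, k)).
Qed.

(** When [D] is closed, its orthogonal projection turns [f] into a Bessel
    sequence [f'] that is still dual to [g]; synthesis with [f'] then solves
    [B x = z]. *)
Lemma closed_SCO (D : set H) :
  bounded_below_biorthogonal dot f D -> closed D -> SCO_sequence dot f.
Proof.
move=> DB Dcl; have [C [g [C0 gC fg Dg _]]] := bounded_below_dual DB.
have [Dsub _ [A A0 DA] _] := DB.
have /choice[f' f'P] n : exists p, D p /\ forall d, D d -> dot (f n - p) d = 0.
  by have [p Dp pO] := orth_projection (f n) Dsub; exists p; split=> //; exact: Dcl.
have f'E n d : D d -> dot (f' n) d = dot (f n) d.
  move=> Dd; have [_ /(_ d Dd)] := f'P n; rewrite dotBl => /eqP.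
  by rewrite subr_eq0 => /eqP.
have [||K K0 Kf'] := @uniform_boundedness ((nat -> R[i]) * nat)
    (fun p => lincomb f' p.1 p.2) (fun p => Num.sqrt (psum p.1 p.2)).
- by move=> p; exact: sqrtr_ge0.
- move=> z; have [p /Dcl Dp pO] := orth_projection z Dsub.
  have /andP[_ p2] := DA p Dp.
  exists (Num.sqrt (fine (sqsum (analysis_op dot f p)))) => -[a k] /=.
  have -> : dot z (lincomb f' a k) =
      \sum_(n < k) analysis_op dot f p n * Num.conj (a n).
    rewrite dot_lincombr; apply: eq_bigr => n _; rewrite mulrC; congr (_ * _).
    have [Df' _] := f'P n; rewrite -(subrK p z) dotDl (pO _ Df') add0r.
    by rewrite dotC f'E // -dotC.
  have p0 : 0 <= fine (sqsum (analysis_op dot f p)).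
    exact: le_trans (psum_ge0 _ 0) (psum_le_ell2 0 p2).
  rewrite -(@ler_pXn2r _ 2) ?nnegrE ?mulr_ge0 ?sqrtr_ge0 ?rnorm_ge0 //.
  apply: le_trans (psum_CS _ _ _) _; rewrite exprMn !sqr_sqrtr ?psum_ge0 //.
  by rewrite ler_wpM2r ?psum_ge0 // psum_le_ell2.
have f'K : bessel (K ^+ 2) f'.
  move=> a k; rewrite -(sqr_sqrtr (psum_ge0 a k)) -exprMn.
  rewrite ler_pXn2r ?nnegrE ?mulr_ge0 ?rnorm_ge0 ?sqrtr_ge0 ?(ltW K0) //.
  exact: (Kf' (a, k)).
exists (mixed_op gC h1); first exact: dual_orthonormalizer.
move=> z _; exists (synth f' (fun n => dot z (h n))) => //.
rewrite /= /mixed -[RHS](onb_expansion hB) /mixed; congr synth.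
apply/funext => n; apply: synth_biorth f'K (bessel_ell2 z h1) _ => m.
by rewrite f'E.
Qed.

(** The kernel of the cross operator is the orthogonal complement of [g], whose span
    is dense because it approximates [D]. *)
Lemma dense_ICO (D : set H) : bounded_below_biorthogonal dot f D ->
  closure D = [set: H] -> ICO_sequence dot f.
Proof.
move=> DB Ddense; have [C [g [C0 gC fg Dg Dspan]]] := bounded_below_dual DB.
exists (mixed_op gC h1); first exact: dual_orthonormalizer.
move=> x y /eqP; rewrite -subr_eq0 -linearB => /eqP B0.
apply/eqP; rewrite -subr_eq0; apply/eqP.
apply: (@closure_span_ortho0 [set: H] g) => // [|n].
  by apply/seteqP; split=> // z _; apply: (closure_min Dspan); rewrite Ddense.
apply: dot0C; rewrite -(mixed_biorth gC h1 (n := n) _ (y := h n)) => [|m].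
  by rewrite -[mixed _ _ _]/(mixed_op gC h1 _) B0 dot0l.
exact: (proj1 hB).
Qed.

End Orthonormalizers.

(** The range of the adjoint of an orthonormalizer [B] is bounded below, because
    [<B^* y, f n> = <y, B (f n)>] are the coordinates of [y] in an orthonormal
    basis, so that their square sum is [|y|^2]. *)
Section FromOrthonormalizer.
Variables (f : nat -> H) (B : {linear H -> H}).
Hypothesis fB : orthonormalizer dot f B.

Let e := B \o f.
Let eB : orthonormal_basis dot [set: H] e := proj2 fB.

Lemma orthonormalizer_bound :
  exists2 M : R, 0 < M & forall x, rnorm (B x) <= M * rnorm x.
Proof.
have [[M BM] _] := fB; exists (`|M| + 1) => [|x]; first by rewrite ltr_wpDl.
apply: le_trans (BM x) _; rewrite ler_wpM2r ?rnorm_ge0 //.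
by apply: le_trans (ler_norm M) _; rewrite lerDl.
Qed.

Lemma CO_Riesz_Fischer : Riesz_Fischer_sequence f.
Proof.
have [M M0 BM] := orthonormalizer_bound; apply/Riesz_FischerP.
exists (M ^+ 2)^-1 => [|a k]; first by rewrite invr_gt0 exprn_gt0.
rewrite ler_pdivrMl ?exprn_gt0 // -exprMn -(rnorm_lincomb_orthonormal a k (proj1 eB)).
rewrite -linear_lincomb.
by rewrite ler_pXn2r ?nnegrE ?mulr_ge0 ?rnorm_ge0 ?(ltW M0).
Qed.

Definition adjoint_range : set H := range (adjoint e B).

Let analysis_adjoint y :
  analysis_op dot f (adjoint e B y) = (fun n => dot y (e n)).
Proof.
have [M M0 BM] := orthonormalizer_bound.
by apply/funext => n; rewrite /analysis_op (adjointE eB BM) // ltW.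
Qed.

Let adjoint_linear : linear (adjoint e B).
Proof.
have [M M0 BM] := orthonormalizer_bound.
exact: mixed_linear (image_bessel BM (ltW M0) (onb_bessel eB)) (onb_bessel eB).
Qed.

Lemma adjoint_range_bounded_below : bounded_below_biorthogonal dot f adjoint_range.
Proof.
have [M M0 BM] := orthonormalizer_bound.
have fg : biorthogonal f (adjoint e B \o e).
  apply: biorthogonalC => n k.
  rewrite -[dot _ _]/(analysis_op dot f (adjoint e B (e n)) k) analysis_adjoint.
  by have [eo _] := eB; exact: eo.
split.
- apply/submodP; split=> [|c _ _ [x _ <-] [y _ <-]].
    by exists (0 - 0) => //; rewrite addrC -scaleN1r adjoint_linear scaleN1r addNr.
  by exists (c *: x + y) => //; exact: adjoint_linear.
- by apply: biorthogonal_infinite_dim fg _ => n; exists (e n).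
- exists (M ^+ 2)^-1 => [|_ [y _ <-]]; first by rewrite invr_gt0 exprn_gt0.
  rewrite analysis_adjoint (parseval eB) ltry andbT lee_fin.
  rewrite ler_pdivrMl ?exprn_gt0 //.
  have := mixed_le (image_bessel BM (ltW M0) (onb_bessel eB)) (onb_bessel eB) y.
  by rewrite mul1r mulr1.
- by exists (adjoint e B \o e) => [n|]; [exists (e n)|exact: fg].
Qed.

(** Surjectivity of [B] makes its adjoint bounded below, by the uniform
    boundedness principle, so that the range of the adjoint is closed. *)
Lemma adjoint_range_closed : set_surj [set: H] [set: H] B -> closed adjoint_range.
Proof.
have [M M0 BM] := orthonormalizer_bound => surj.
have [||K K0 Ky] := @uniform_boundedness H id (fun y => rnorm (adjoint e B y)).
- by move=> y; exact: rnorm_ge0.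
- move=> z; have [x _ <-] := surj z Logic.I; exists (rnorm x) => y.
  by rewrite dotC rnorm_conj -(adjointE eB BM) ?(ltW M0) // mulrC dot_CS.
have adjB x y : adjoint e B x - adjoint e B y = adjoint e B (x - y).
  by rewrite [in RHS]addrC -[in RHS]scaleN1r adjoint_linear scaleN1r addrC.
move=> x /closure_cvgP[u Du ux].
have /choice[v vu] n : exists y, adjoint e B y = u n.
  by have [y _ <-] := Du n; exists y.
have v_cvg : cvgn v.
  apply: rnorm_cauchy => eps eps0.
  have e2 : 0 < eps / K / 2 by rewrite !divr_gt0.
  have /cvg_rnormP/(_ _ e2)[N uN] := ux; exists N => n m /andP[Nn nm].
  apply: le_lt_trans (Ky (v m - v n)) _; rewrite -adjB !vu mulrC -ltr_pdivlMr //.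
  apply: le_lt_trans (ler_rnorm_dist _ x _) _; rewrite (splitr (eps / K)).
  by rewrite (rnorm_distC x) ltrD // uN // (leq_trans Nn).
exists (limn v) => //.
pose adj : {linear H -> H} :=
  HB.pack (adjoint e B) (GRing.isLinear.Build _ _ _ _ (adjoint e B) adjoint_linear).
have [L Ladj] := mixed_bounded (image_bessel BM (ltW M0) (onb_bessel eB)) (onb_bessel eB).
have Ladj' y : rnorm (adj y) <= `|L| * rnorm y.
  by apply: le_trans (Ladj y) _; rewrite ler_wpM2r ?rnorm_ge0 // ler_norm.
have lim := bounded_linear_cvg Ladj' (normr_ge0 L) v_cvg.
apply: (cvg_unique (@norm_hausdorff _ H) lim).
by have -> : (fun n => adj (v n)) = u by apply/funext => n; exact: vu.
Qed.

(** The orthogonal complement of the range of the adjoint is the kernel of [B]. *)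
Lemma adjoint_range_dense : injective B -> closure adjoint_range = [set: H].
Proof.
move=> Binj; have [M M0 BM] := orthonormalizer_bound.
have [Dsub _ _ _] := adjoint_range_bounded_below.
apply/seteqP; split=> // x _; have [p Dp pO] := orth_projection x Dsub.
suff /eqP : x - p = 0 by rewrite subr_eq0 => /eqP ->.
apply: Binj; rewrite linear0; apply/eqP; rewrite -(dnorm_eq0 dot); apply/eqP.
rewrite -(adjointE eB BM) ?(ltW M0) //; apply: dot0C; apply: pO.
by exists (B (x - p)).
Qed.

End FromOrthonormalizer.

(** * Frame operators and their square roots *)

Lemma frame_dot C g x : bessel C g ->
  dot (mixed g g x) x = ((fine (sqsum (fun n => dot x (g n))))%:C)%C.
Proof.
move=> gC; have x2 := bessel_ell2 x gC; set a := fun n => _.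
pose s k : R[i] := ((psum a k)%:C)%C.
apply: (@dot_cvg_unique _ _ _ s _ (@mixed_cvg _ _ _ _ gC gC x)) => [|k].
  apply/cvg_rnormP => e e0; have /cvgrPdist_lt/(_ _ e0)[N _ Na] := psum_cvg x2.
  exists N => n /Na /=; rewrite /s distrC -rnormC; apply: le_lt_trans.
  by rewrite rmorphB.
rewrite dot_lincombl /s /psum rmorph_sum /=; apply: eq_bigr => n _.
by rewrite sqr_rnorm -dotC.
Qed.

Section SynthesisOperator.
Variables (C : R) (g : nat -> H).
Hypothesis gC : bessel C g.

Let T (a : ell2_type R) : H := synth g a.

Let T_linear : linear T.
Proof.
move=> c a b; rewrite /T -(synthP c gC); first by congr synth.
- by have := ell2_valP a; rewrite inE.
- by have := ell2_valP b; rewrite inE.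
Qed.

Definition synthesis_op : {linear ell2_type R -> H} :=
  HB.pack T (GRing.isLinear.Build _ _ _ _ T T_linear).

Let analysis_mem x : (fun n => dot x (g n)) \in ell2_pred R.
Proof. by rewrite inE; exact: bessel_ell2 gC. Qed.

Let Tstar x : ell2_type R := Ell2 (analysis_mem x).

Let Tstar_linear : linear Tstar.
Proof.
by move=> c x y; apply/val_inj/funext => n; rewrite /= dotDl dotZl.
Qed.

Definition synthesis_adjoint : {linear H -> ell2_type R} :=
  HB.pack Tstar (GRing.isLinear.Build _ _ _ _ Tstar Tstar_linear).

Lemma synthesis_op_bounded : bounded_op (@l2norm R) (@rnorm R H) synthesis_op.
Proof.
have C0 := bessel_ge0 gC.
exists (Num.sqrt C) => a; have := ell2_valP a; rewrite inE => a2.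
have a0 : 0 <= fine (sqsum a) := le_trans (psum_ge0 _ 0) (psum_le_ell2 0 a2).
rewrite -(@ler_pXn2r _ 2) ?nnegrE ?mulr_ge0 ?sqrtr_ge0 ?rnorm_ge0 //.
rewrite exprMn /l2norm !sqr_sqrtr //; apply: synth_le => // k.
exact: psum_le_ell2.
Qed.

Lemma synthesis_adjointP : is_adjoint (@l2dot R) dot synthesis_op synthesis_adjoint.
Proof.
move=> a x; have := ell2_valP a; rewrite inE => a2.
apply/esym/(cvg_lim (@norm_hausdorff _ R[i]^o)).
have -> : series (fun n => a n * Num.conj (synthesis_adjoint x n) : R[i]^o) =
    (fun k => dot (lincomb g a k) x : R[i]^o).
  apply/funext => k; rewrite /series /= big_mkord dot_lincombl.
  by apply: eq_bigr => n _; rewrite -dotC.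
exact: dot_cvgl (synth_cvg gC a2).
Qed.

End SynthesisOperator.

(** The square root [S] of the frame operator of the dual sequence [g] works.
    It satisfies [|S y|^2 = sum_n |<y, g n>|^2] and [S (S (f n)) = g n], so the
    [S (f n)] are orthonormal; truncating the expansion of [S y] in them leaves
    the tail of that sum, so they span the range of [S] densely, and the closure
    of that range is that of [D]. *)
Lemma bounded_below_sqrt f (D : set H) : bounded_below_biorthogonal dot f D ->
  exists (T : {linear ell2_type R -> H}) (Tstar : {linear H -> ell2_type R})
         (S : {linear H -> H}),
    [/\ bounded_op (@l2norm R) (@rnorm R H) T,
        is_adjoint (@l2dot R) dot T Tstar,
        is_positive_sqrt dot (T \o Tstar) S,
        (forall n, closure D (S (f n))) &
        orthonormal_basis dot (closure D) (S \o f)].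
Proof.
move=> DB; have [C [g [C0 gC fg Dg Dspan]]] := bounded_below_dual DB.
have [Dsub _ _ _] := DB; have gf := biorthogonalC fg.
pose P := mixed_op gC gC.
pose an x : nat -> R[i] := fun n => dot x (g n).
have an2 x : ell2 R (an x) := bessel_ell2 x gC.
have [S SP] : exists S : {linear H -> H}, is_positive_sqrt dot P S.
  apply: exists_positive_sqrt C0 _ _ => [x y|x]; first exact: (mixed_adjoint x y gC gC).
  rewrite -[P x]/(mixed g g x) (frame_dot x gC) /=; apply: synth_le => // k.
  exact: psum_le_ell2 k (an2 x).
have [[L SL] Ssym S0 SS] := SP.
have Snorm x : rnorm (S x) ^+ 2 = fine (sqsum (an x)).
  by rewrite rnormE_dot -Ssym SS -[P x]/(mixed g g x) (frame_dot x gC).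
have SSf n : S (S (f n)) = g n.
  by rewrite SS; apply: mixed_dual => m; rewrite fg eq_sym.
have So : orthonormal_seq (S \o f) by move=> n k; rewrite /= -Ssym SSf gf.
have SD y : closure D (S y).
  have [p Dp pO] := orth_projection (S y) Dsub; set q := S y - p in pO.
  have Sq : S q = 0.
    apply: rnorm0_eq0; apply/eqP; rewrite -sqrf_eq0 Snorm; apply/eqP.
    have -> : an q = (fun=> 0) by apply/funext => n; exact: (pO _ (Dg n)).
    rewrite /sqsum eseries0 // => n _ _.
    by rewrite rnorm0 expr0n.
  have pq : dot p q = 0 by apply: closure_dot0 Dp => d /pO/dot0C.
  have : dot q q = 0 by rewrite {1}/q dotBl Ssym Sq dot0r pq subrr.
  by move/eqP; rewrite dnorm_eq0 subr_eq0 => /eqP ->.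
have SK y : closure (lin_span (range (S \o f))) (S y).
  apply/closure_rnormP => e e0.
  have e2 : 0 < e ^+ 2 / 2 by rewrite divr_gt0 // exprn_gt0.
  have [N Na] := sqsum_tail_cvg (an2 y) e2.
  exists (lincomb (S \o f) (an y) N); first exact: lin_span_lincomb.
  rewrite -linear_lincomb -linearB -(@ltr_pXn2r _ 2) ?nnegrE ?rnorm_ge0 ?(ltW e0) //.
  rewrite Snorm; have -> : an (y - lincomb f (an y) N) = tail N (an y).
    apply/funext => n; rewrite /an dotBl (@dot_lincomb_biorth _ _ _ n) => [|m].
      by rewrite /cut /tail; case: ifP; rewrite ?subrr ?subr0.
    exact: fg.
  have := Na N (leqnn N); rewrite (ell2E (tail_ell2 N (an2 y))) lee_fin.
  by move=> /le_lt_trans; apply; move: e2; lra.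
exists (synthesis_op gC), (synthesis_adjoint gC), S; split=> //.
- exact: synthesis_op_bounded.
- exact: synthesis_adjointP.
- split=> //; apply/seteqP; split.
    apply: closure_min; apply: lin_span_sub (submod_closure Dsub) _ => _ [n _ <-].
    exact: SD.
  apply: closure_min => d /Dspan; apply: closure_min.
  apply: lin_span_sub (submod_closure (lin_span_submod _)) _ => _ [n _ <-].
  by rewrite -SSf; exact: SK.
Qed.

End Hilbert.

(** * The equivalences *)

Theorem corollary4p1 (R : realType) (H : completeNormedModType R[i])
    (dot : {dot H for Num.conj}) (f : nat -> H) :
  (forall x : H, `|x| ^+ 2 = dot x x) ->
  separable_space H ->
  infinite_dim [set: H] ->
  [/\ [<-> CO_sequence dot f;
           set_surj (analysis_dom dot f) (ell2 R) (analysis_op dot f);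
           exists D : set H, bounded_below_biorthogonal dot f D;
           Riesz_Fischer_sequence f],
      (forall D : set H, bounded_below_biorthogonal dot f D -> closed D ->
         SCO_sequence dot f) /\
      (SCO_sequence dot f ->
         exists2 D : set H, bounded_below_biorthogonal dot f D & closed D),
      (forall D : set H, bounded_below_biorthogonal dot f D ->
         closure D = [set: H] -> ICO_sequence dot f) /\
      (ICO_sequence dot f ->
         exists2 D : set H, bounded_below_biorthogonal dot f D &
           closure D = [set: H]) &
      forall D : set H, bounded_below_biorthogonal dot f D ->
        exists (T : {linear ell2_type R -> H}) (Tstar : {linear H -> ell2_type R})
               (S : {linear H -> H}),
          [/\ bounded_op (@l2norm R) (@rnorm R H) T,
              is_adjoint (@l2dot R) dot T Tstar,
              is_positive_sqrt dot (T \o Tstar) S,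
              (forall n, closure D (S (f n))) &
              orthonormal_basis dot (closure D) (S \o f)]].
Proof.
move=> dotE Hsep Hinf; have [h hB] := exists_onb dotE Hinf Hsep; split.
- tfae.
  + by case=> B /(CO_Riesz_Fischer dotE)/(Riesz_Fischer_dual dotE)/(dual_surjective dotE).
  + move=> /(surjective_Riesz_Fischer dotE hB)/(Riesz_Fischer_dual dotE).
    exact: dual_bounded_below.
  + case=> D /bounded_below_dual[C [g [C0 gC fg _ _]]].
    by apply: (dual_Riesz_Fischer dotE); exists C, g.
  + by move=> /(Riesz_Fischer_dual dotE)/(dual_CO dotE hB).
- split; first exact: (closed_SCO dotE hB).
  case=> B fB Bsurj; exists (adjoint_range dot f B).
    exact: adjoint_range_bounded_below.
  exact: adjoint_range_closed.
- split; first exact: (dense_ICO dotE hB).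
  case=> B fB Binj; exists (adjoint_range dot f B).
    exact: adjoint_range_bounded_below.
  exact: adjoint_range_dense.
- exact: bounded_below_sqrt.
Qed.
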